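(* Let $G=(L,H)$ be a finite partial-monitoring game with two outcomes ($M=2$) that satisfies the non-degeneracy condition. Let $\mathcal S$ be the set of all finite partial-monitoring games with two outcomes that satisfy the separation condition. Let $K$ be the number of non-dominated actions in $G$, counting duplicate actions only once. Then the minimax expected regret $R_T(G)$ satisfies: (1) if $K=1$, then $R_T(G)=0$ for all $T$; (2) if $K\ge 2$ and $G\in\mathcal S$, then $R_T(G)=\widetilde\Theta(\sqrt T)$; (3) if $K\ge 2$, $G\notin\mathcal S$ and $G$ has a revealing action, then $R_T(G)=\Theta(T^{2/3})$; (4) otherwise, $R_T(G)=\Theta(T)$.
   Context: Games. For an integer $n$ write $\underline n=\{1,\dots,n\}$. A finite partial-monitoring game $G=(L,H)$ is a pair of $N\times M$ matrices ($N$ actions, $M$ outcomes): the loss matrix $L=(\ell_{i,j})$ has real entries, the feedback matrix $H=(h_{i,j})$ has entries in an alphabet $\Sigma$. The $i$-th row of $L$ is $\ell_i\in\mathbb R^M$, the loss vector of action $i$. $\Delta_M$ is the probability simplex in $\mathbb R^M$. Both matrices are known to the learner. The game lasts $T\ge 1$ rounds. The outcome sequence $J_1,\dots,J_T\in\underline M$ is fixed before the first round. In round $t$ the learner chooses an action $I_t\in\underline N$ and then observes only $h_{I_t,J_t}$. A randomized strategy (algorithm) $A$ is a sequence of functions $I_t:\Sigma^{t-1}\times\Omega\to\underline N$, $t=1,\dots,T$, of the past feedback and of the learner's internal randomness (with $\Omega$ a probability space). Regret. $R_T(A,G)=\mathbb E\big[\sum_{t=1}^T\ell_{I_t,J_t}-\min_{i\in\underline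 N}\sum_{t=1}^T\ell_{i,J_t}\big]$ (depending on $J_{1:T}$). The minimax expected regret is $R_T(G)=\inf_A\sup_{J_{1:T}\in\underline M^T}R_T(A,G)$, the infimum being over all randomized strategies. Properties of actions. Action $i$ is dominated if for every $p\in\Delta_M$ there is an action $i'$ with $\ell_{i'}\ne\ell_i$ and $\langle\ell_{i'},p\rangle\le\langle\ell_i,p\rangle$; otherwise it is non-dominated. Action $i$ is degenerate if it is dominated and there is $p\in\Delta_M$ with $\langle\ell_i,p\rangle\le\langle\ell_{i'},p\rangle$ for all $i'\in\underline N$. Two or more actions with the same loss vector are called duplicate. For $M=2$, action $i$ is revealing if $h_{i,1}\ne h_{i,2}$ and non-revealing if $h_{i,1}=h_{i,2}$. Removing duplicate actions in a two-outcome game means: for each group of actions with the same loss vector keep exactly one action (with its rows of $L$ and $H$), namely a revealing one if the group contains a revealing action, and otherwise any one of them. Chain of non-dominated actions (two outcomes, no duplicates): the sequence $(i_1,\dots,i_K)$ of the non-dominated actions ordered according to their loss for the first outcome, $\ell_{i,1}$. Separation condition: a two-outcome game satisfies it if, after removing duplicate actions, its chain of non-dominated actions does not contain a pair of consecutive actions $i_k,i_{k+1}$ that are both non-revealing. Non-degeneracy condition: a two-outcome game is degenerate if it has a degenerate revealing action; otherwise it is non-degenerate, i.e. satisfies the non-degeneracy condition. Asymptotics are in $T$ with $G$ fixed (constants may depend on $G$): $f(T)=\Theta(g(T))$ has the usual meaning, and $f(T)=\widetilde\Theta(g(T))$ is the same up to poly-logarithmic factors in $T$, i.e. there are $c,C>0$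 and $q\ge 0$ with $c\,g(T)(\ln T)^{-q}\le f(T)\le C\,g(T)(\ln T)^{q}$ for all $T\ge 2$. *)

(* Defs.v *)
From HB Require Import structures.
From mathcomp Require Import all_boot all_order all_algebra.
From mathcomp Require Import all_classical all_reals all_analysis.

Set Implicit Arguments.
Unset Strict Implicit.
Unset Printing Implicit Defensive.
Import Order.TTheory GRing.Theory Num.Theory.

Local Open Scope classical_set_scope.
Local Open Scope ring_scope.

(* Actions and outcomes are numbered from 0. A game has N = nact.+1 actions, so
   that there is at least one. *)
Record game (R : realType) (Sigma : eqType) (M : nat) := Game {
  nact : nat;
  loss : 'M[R]_(nact.+1, M);
  feedback : 'M[Sigma]_(nact.+1, M) }.

Section Regret.
Context (R : realType) (Sigma : eqType) (M : nat) (G : game R Sigma M).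

(* The functions I_t : Sigma^(t-1) * Omega -> N, t = 1, 2, ... are bundled into
   one function on finite sequences: I_t is its restriction to the histories of
   length t - 1. Values on histories of length >= T play no role in T rounds. *)
Record strategy := Strategy {
  rand_disp : measure_display;
  rand_space : measurableType rand_disp;
  rand_prob : probability rand_space R;
  select : seq Sigma -> rand_space -> 'I_(nact G).+1;
  measurable_select : forall (s : seq Sigma) (i : 'I_(nact G).+1),
    measurable [set w | select s w = i] }.
Arguments select : clear implicits.

(* The actions chosen by the deterministic rule I against the outcomes Js, when
   s is the feedback received before the first of these outcomes. *)
Fixpoint play (I : seq Sigma -> 'I_(nact G).+1) (s : seq Sigma)
    (Js : seq 'I_M) : seq 'I_(nact G).+1 :=
  if Js is j :: Js' then
    I s :: play I (rcons s (feedback G (I s) j)) Js'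
  else [::].

Definition learner_loss (I : seq Sigma -> 'I_(nact G).+1) (Js : seq 'I_M) : R :=
  \sum_(x <- zip (play I [::] Js) Js) loss G x.1 x.2.

Definition action_loss (i : 'I_(nact G).+1) (Js : seq 'I_M) : R :=
  \sum_(j <- Js) loss G i j.

Definition best_loss (Js : seq 'I_M) : R :=
  \big[Num.min/action_loss ord0 Js]_i action_loss i Js.

Definition regret (I : seq Sigma -> 'I_(nact G).+1) (Js : seq 'I_M) : R :=
  learner_loss I Js - best_loss Js.

Definition expected_regret (A : strategy) (Js : seq 'I_M) : \bar R :=
  ('E_(rand_prob A)[fun w => regret (fun s => select A s w) Js])%E.

Definition worst_regret (T : nat) (A : strategy) : \bar R :=
  ereal_sup (range (fun J : T.-tuple 'I_M => expected_regret A J)).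

Definition minimax_regret (T : nat) : \bar R :=
  ereal_inf [set r | exists A : strategy, r = worst_regret T A].

End Regret.

Section Actions.
Context (R : realType) (Sigma : eqType) (M : nat) (G : game R Sigma M).
Implicit Types (i : 'I_(nact G).+1) (p : 'rV[R]_M).

Definition in_simplex p : Prop :=
  (forall j, 0 <= p 0 j) /\ \sum_j p 0 j = 1.

Definition mean_loss i p : R := \sum_j loss G i j * p 0 j.

Definition duplicate i i' : bool := row i (loss G) == row i' (loss G).

Definition dominated i : Prop := forall p, in_simplex p ->
  exists i', ~~ duplicate i' i /\ mean_loss i' p <= mean_loss i p.

Definition degenerate i : Prop :=
  dominated i /\
  exists p, in_simplex p /\ forall i', mean_loss i p <= mean_loss i' p.

Definition nondominated_actions : seq 'I_(nact G).+1 :=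
  [seq i <- enum 'I_(nact G).+1 | ~~ `[< dominated i >]].

(* Duplicate actions count once: these are the distinct loss vectors. *)
Definition num_nondominated : nat :=
  size (undup [seq row i (loss G) | i <- nondominated_actions]).

End Actions.

Section TwoOutcomes.
Context (R : realType) (Sigma : eqType).
Implicit Types G : game R Sigma 2.

Definition outcome1 : 'I_2 := ord0.
Definition outcome2 : 'I_2 := ord_max.

Definition revealing G (i : 'I_(nact G).+1) : bool :=
  feedback G i outcome1 != feedback G i outcome2.

Definition nondegenerate_game G : Prop :=
  ~ exists i : 'I_(nact G).+1, degenerate i /\ revealing i.

(* G' results from G by removing duplicate actions; f k is the action of G that
   is kept as the action k of G'. *)
Definition duplicates_removed G G' : Prop :=
  exists f : 'I_(nact G').+1 -> 'I_(nact G).+1,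
    [/\ loss G' = rowsub f (loss G),
        feedback G' = rowsub f (feedback G),
        forall k k', duplicate (f k) (f k') -> k = k',
        forall i, exists k, duplicate (f k) i &
        forall k i, duplicate (f k) i -> revealing i -> revealing (f k)].

Definition chain G : seq 'I_(nact G).+1 :=
  sort (fun i i' => loss G i outcome1 <= loss G i' outcome1)
       (nondominated_actions G).

(* [sorted e s] says that e holds between any two consecutive items of s. The
   condition does not depend on the choice of G'. *)
Definition separation_condition : set (game R Sigma 2) :=
  [set G | exists G', duplicates_removed G G' /\
     sorted (fun i i' => revealing i || revealing i') (chain G')].

End TwoOutcomes.

Section Asymptotics.
Context (R : realType).
Implicit Types (f : nat -> \bar R) (g : nat -> R).

(* The library's 'Theta is for functions with values in a normed module, which
   \bar R is not. *)
Definition is_Theta f g : Prop :=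
  exists c C : R, [/\ 0 < c, 0 < C &
    \forall T \near \oo, ((c * g T)%:E <= f T <= (C * g T)%:E)%E].

Definition is_soft_Theta f g : Prop :=
  exists c C q : R, [/\ 0 < c, 0 < C, 0 <= q &
    forall T : nat, (2 <= T)%N ->
      ((c * g T * ln T%:R `^ (- q))%:E <= f T
         <= (C * g T * ln T%:R `^ q)%:E)%E].

End Asymptotics.

(* Main.v *)
Require Import Defs.
From HB Require Import structures.
From mathcomp Require Import all_boot all_order all_algebra.
From mathcomp Require Import all_classical all_reals all_analysis measurable_realfun.
From mathcomp Require Import zify ring lra.

(** Lower bounds. If two consecutive non-dominated actions a and b tie at the
outcome distribution x0, then all actions are at least as bad there. Move from
x0 by a factor theta towards a point where a is strictly optimal, respectively
b: no action is good in both environments, the sum of its two gaps being at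
least of order theta. Let u and v be the probabilities of the past outcomes in
the two environments; with [harmonic u v = uv / (u + v)], the sum of the regrets
weighted by u and v is at least of order [n theta (harmonic u v)] over n rounds.
Only a revealing action changes u : v, and it decreases [harmonic] by at most
O(theta^2 (u + v)). Taking theta of order T^(-1/2) gives sqrt T. If every
revealing action has a positive gap at x0, which is what the failure of the
separation condition and non-degeneracy provide, then the decrease is paid for as
long as T theta^3 = O(1), which gives T^(2/3). Without revealing actions
constant outcome sequences give T.

Upper bounds. A revealing action shows the outcome, so exponential weights p on
the non-dominated actions can be run with losses estimated from the revealing
rounds only, relative to a reference action m. The second-order term of the
estimates is then bounded by (1 - p m) / Q, where Q is the probability of
revealing. Exploring with probability T^(-1/3) gives T^(2/3). Under the
separation condition, between two non-revealing non-dominated actions there is a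
revealing one, whose loss vector lies below their chord; part of the mass of both
can be moved to it at no loss, which makes Q at least of order 1 - p m for the
heaviest non-revealing m, and gives sqrt T. *)

Set Implicit Arguments.
Unset Strict Implicit.
Unset Printing Implicit Defensive.
Import Order.TTheory GRing.Theory Num.Theory.

Local Open Scope classical_set_scope.
Local Open Scope ring_scope.

(** * Randomized strategies *)

Section FiniteMixture.
Context (R : realType) (n : nat) (P : 'I_n.+1 -> R).
Hypothesis P_ge0 : forall w, 0 <= P w.

Let weighted_dirac (k : nat) : {measure set nat -> \bar R} :=
  mscale (NngNum (P_ge0 (inord k))) \d_k.

(** The mass is put on [nat], whose sigma-algebra is discrete, so that every function of the
    randomness is measurable. *)
Definition mixture (_ : \sum_w P w = 1) : set nat -> \bar R :=
  msum weighted_dirac n.+1.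

HB.instance Definition _ sum1 := Measure.on (mixture sum1).

Let mixtureT sum1 : mixture sum1 setT = 1%E.
Proof.
rewrite /mixture /msum -[1%E]/(1%:E) -sum1 -sumEFin; apply: eq_bigr => k _.
by rewrite /weighted_dirac /= /mscale /= diracT mule1 inord_val.
Qed.

HB.instance Definition _ sum1 :=
  Measure_isProbability.Build _ _ _ (mixture sum1) (mixtureT sum1).

(** The formula for a sum of measures is applied to a nonnegative integrand, so f is first shifted
    by its bound C. Boundedness gives the integrability needed to subtract C again. *)
Lemma integral_mixture (sum1 : \sum_w P w = 1) (f : nat -> R) (C : R) :
    (forall k, `|f k| <= C) ->
  (\int[mixture sum1]_k (f k)%:E)%E = (\sum_(k < n.+1) P k * f k)%:E.
Proof.
move=> fC.
have mf (g : nat -> \bar R) : measurable_fun setT g by [].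
have fin : (mixture sum1 setT < +oo)%E by rewrite mixtureT ltry.
have intC : (mixture sum1).-integrable setT (EFin \o cst C).
  apply: measurable_bounded_integrable => //.
  by exists `|C|; split=> [|y Cy k _ /=]; [exact: num_real|exact: ltW].
have intf : (mixture sum1).-integrable setT (EFin \o f).
  apply: measurable_bounded_integrable => //.
  by exists C; split=> [|y Cy k _ /=]; [exact: num_real|exact: le_trans (fC k) (ltW Cy)].
have addC : (\int[mixture sum1]_k (f k + C)%:E = \int[mixture sum1]_k (f k)%:E + C%:E)%E.
  under eq_integral do rewrite EFinD.
  rewrite integralD//; congr (_ + _)%E.
  by rewrite integral_cst// [X in (_ * X)%E]probability_setT mule1.
have sumC : (\int[mixture sum1]_k (f k + C)%:E = (\sum_(k < n.+1) P k * (f k + C))%:E)%E.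
  have fC0 k : (0 <= (f k + C)%:E)%E.
    by rewrite lee_fin; move: (fC k); rewrite ler_norml => /andP[? _]; lra.
  rewrite ge0_integral_measure_sum// -sumEFin; apply: eq_bigr => k _.
  rewrite ge0_integral_mscale//= integral_dirac// diracT mul1e inord_val.
  by rewrite EFinM.
rewrite sumC in addC.
have -> : \sum_(k < n.+1) P k * f k = \sum_(k < n.+1) P k * (f k + C) - C.
  by under [in RHS]eq_bigr do rewrite mulrDr; rewrite big_split /= -mulr_suml sum1 mul1r addrK.
by rewrite EFinB addC addeK.
Qed.

End FiniteMixture.

(** * Losses along a play, and mixtures of finitely many deterministic rules *)

Section Play.
Context (R : realType) (Sigma : eqType) (M : nat) (G : game R Sigma M).
Notation action := 'I_(nact G).+1.
Notation aloss := (@action_loss R Sigma M G).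
Implicit Types (I : seq Sigma -> action) (s : seq Sigma) (Js : seq 'I_M).

Definition loss_from I s Js : R :=
  \sum_(x <- zip (play I s Js) Js) loss G x.1 x.2.

Lemma loss_from_cons I s j Js : loss_from I s (j :: Js) =
  loss G (I s) j + loss_from I (rcons s (feedback G (I s) j)) Js.
Proof. by rewrite /loss_from /= big_cons. Qed.

Lemma loss_from_shift I x s Js :
  loss_from I (x :: s) Js = loss_from (fun s => I (x :: s)) s Js.
Proof.
elim: Js s => [|j Js IH] s; first by rewrite /loss_from /= !big_nil.
by rewrite !loss_from_cons rcons_cons IH.
Qed.

Lemma best_loss_le i Js : best_loss G Js <= aloss i Js.
Proof. exact: bigmin_le. Qed.

Lemma best_loss_attained Js : exists i : action, best_loss G Js = aloss i Js.
Proof.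
rewrite /best_loss; elim/big_ind: _ => [|x y [i ->] [i' ->]|i _]; [by exists ord0| |by exists i].
by rewrite /Num.min; case: ifP => _; [exists i|exists i'].
Qed.

Definition loss_bound : R := \sum_(x : action * 'I_M) `|loss G x.1 x.2|.

Lemma le_loss_bound i j : `|loss G i j| <= loss_bound.
Proof.
rewrite /loss_bound (bigD1 (i, j)) //= lerDl.
exact: sumr_ge0.
Qed.

Lemma action_loss_bound i Js : `|aloss i Js| <= (size Js)%:R * loss_bound.
Proof.
rewrite /action_loss; elim: Js => [|j Js IH]; first by rewrite big_nil normr0 mul0r.
rewrite big_cons -natr1 mulrDl mul1r addrC.
by rewrite (le_trans (ler_normD _ _)) // lerD // le_loss_bound.
Qed.

Lemma loss_from_bound I s Js : `|loss_from I s Js| <= (size Js)%:R * loss_bound.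
Proof.
elim: Js s => [|j Js IH] s; first by rewrite /loss_from big_nil normr0 mul0r.
rewrite loss_from_cons -natr1 mulrDl mul1r addrC.
by rewrite (le_trans (ler_normD _ _)) // lerD // le_loss_bound.
Qed.

Lemma regret_bound I Js : `|regret I Js| <= (size Js)%:R * (2 * loss_bound).
Proof.
have [i bE] := best_loss_attained Js.
rewrite /regret bE mulrCA mulrDl mul1r (le_trans (ler_normB _ _)) //.
by apply: lerD; [exact: loss_from_bound|exact: action_loss_bound].
Qed.

(** As the history [s] is fixed, the next action cuts the sample space into finitely many measurable
    pieces, and on each of them the next history is fixed again. *)
Lemma measurable_loss_from d (T : measurableType d) (I : seq Sigma -> T -> action) :
    (forall s i, measurable [set w | I s w = i]) ->
  forall Js s, measurable_fun setT (fun w => loss_from (I^~ w) s Js).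
Proof.
move=> mI; elim=> [|j Js IH] s.
  rewrite [X in measurable_fun _ X](_ : _ = cst 0) //; apply/funext => w.
  by rewrite /loss_from /= big_nil.
rewrite [X in measurable_fun _ X](_ : _ = fun w => \sum_(i : action)
    \1_[set w | I s w = i] w *
    (loss G i j + loss_from (I^~ w) (rcons s (feedback G i j)) Js)); last first.
  apply/funext => w; rewrite loss_from_cons (bigD1 (I s w)) //= big1 => [|i neq].
    by rewrite addr0 indicE mem_set ?mul1r.
  by rewrite indicE memNset ?mul0r //= => iE; rewrite iE eqxx in neq.
apply: measurable_sum => i; apply: measurable_funM.
  exact: measurable_indic.
by apply: measurable_funD; [exact: measurable_cst|exact: IH].
Qed.

Lemma integrable_regret (A : strategy G) Js :
  (rand_prob A).-integrable setT (fun w => (regret ((@select _ _ _ _ A)^~ w) Js)%:E).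
Proof.
apply: (measurable_bounded_integrable (f := fun w => regret ((@select _ _ _ _ A)^~ w) Js)) => //.
- exact: le_lt_trans (probability_le1 (rand_prob A) measurableT) (ltry 1).
- apply: measurable_funB => //; apply: measurable_loss_from.
  exact: measurable_select.
- exists ((size Js)%:R * (2 * loss_bound)); split=> [|y Cy w _ /=]; first exact: num_real.
  exact: le_trans (regret_bound _ _) (ltW Cy).
Qed.

Lemma mixed_strategy (Om : finType) (P : Om -> R) (I : Om -> seq Sigma -> action) :
    (forall w, 0 <= P w) -> \sum_w P w = 1 ->
  exists A : strategy G, forall Js,
    expected_regret A Js = (\sum_w P w * regret (I w) Js)%:E.
Proof.
move=> P_ge0 P_sum1.
(* Total mass 1 makes [Om] nonempty, so its elements can be numbered as [mixture] requires. *)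
have nE : #|Om|.-1.+1 = #|Om|.
  rewrite prednK // lt0n; apply/eqP => Om0; move/eqP: P_sum1.
  rewrite big_pred0 => [|w]; first by rewrite eq_sym oner_eq0.
  by case: (fintype0 w Om0).
pose e k : Om := enum_val (cast_ord nE k).
have reindex_e (F : Om -> R) : \sum_w F w = \sum_k F (e k).
  apply: reindex; exists (fun w => cast_ord (esym nE) (enum_rank w)) => x _.
    by rewrite /e enum_valK cast_ordK.
  by rewrite /e cast_ordKV enum_rankK.
have Pe_ge0 k : 0 <= P (e k) by [].
have Pe_sum1 : \sum_k P (e k) = 1 by rewrite -reindex_e.
pose A := @Strategy _ _ _ G _ _ (mixture Pe_ge0 Pe_sum1 : probability _ _)
  (fun s (k : nat) => I (e (inord k)) s)
   (fun _ _ => Logic.I).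

have int_prob Js := integral_mixture Pe_ge0 Pe_sum1 (fun k => regret_bound (I (e (inord k))) Js).
exists A => Js; rewrite /expected_regret unlock /=.
rewrite reindex_e; apply: etrans (int_prob Js) _; congr (_%:E).
by apply: eq_bigr => k _; rewrite inord_val.
Qed.

End Play.

(** * Expectations over independent outcomes *)

Lemma outcome_cases (j : 'I_2) : j = outcome1 \/ j = outcome2.
Proof. by case: j => -[|[|//]] lt; [left|right]; exact: val_inj. Qed.

Section MeanOver.
Context (R : realType).
Implicit Types (n : nat) (x : R) (F : seq 'I_2 -> R).

(** The expectation of F over n independent outcomes, each equal to [outcome1] with probability x.
    The recursion is on the first outcome, as in [play]. *)
Fixpoint mean_over n x F : R :=
  if n is n'.+1 then x * mean_over n' x (fun Js => F (outcome1 :: Js)) +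
    (1 - x) * mean_over n' x (fun Js => F (outcome2 :: Js))
  else F [::].

Lemma mean_overDl n x (c : R) F :
  mean_over n x (fun Js => c + F Js) = c + mean_over n x F.
Proof. by elim: n F => //= n IH F; rewrite !IH; ring. Qed.

Lemma ler_mean_over n x F F' : 0 <= x <= 1 ->
  (forall Js, size Js = n -> F Js <= F' Js) -> mean_over n x F <= mean_over n x F'.
Proof.
move=> /andP[x0 x1]; elim: n F F' => [|n IH] F F' FF' /=; first exact: FF'.
by apply: lerD; apply: ler_wpM2l; rewrite ?subr_ge0 //; apply: IH => Js sz;
  apply: FF'; rewrite /= sz.
Qed.

Lemma mean_over_lt n x (c : R) F : 0 <= x <= 1 ->
  (forall Js, size Js = n -> F Js < c) -> mean_over n x F < c.
Proof.
move=> /andP[x0 x1]; elim: n F => [|n IH] F Fc /=; first exact: Fc.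
have lt1 := IH _ (fun Js (sz : size Js = n) => Fc (outcome1 :: Js) (congr1 S sz)).
have lt2 := IH _ (fun Js (sz : size Js = n) => Fc (outcome2 :: Js) (congr1 S sz)).
move: lt1 lt2; set A := mean_over n x _; set B := mean_over n x _ => ltA ltB.
(* Strictness comes from the first branch if x > 0, and from the second if x = 0. *)
have [x_gt0|x_le0] := ltrP 0 x; last by rewrite (_ : x = 0); lra.
have : x * A < x * c by rewrite ltr_pM2l.
have : (1 - x) * B <= (1 - x) * c by apply: ler_wpM2l; lra.
lra.
Qed.

(** Integrability is carried through the induction because linearity of the integral needs it at
    every step. *)
Lemma mean_over_Rintegral d (T : measurableType d) (P : probability T R) n x
    (f : seq 'I_2 -> T -> R) :
  (forall Js, P.-integrable setT (EFin \o f Js)) ->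
  P.-integrable setT (EFin \o (fun w => mean_over n x (f^~ w))) /\
  mean_over n x (fun Js => \int[P]_w f Js w) = \int[P]_w mean_over n x (f^~ w).
Proof.
move=> intf; elim: n f intf => [|n IH] f intf /=; first by split; [exact: intf|].
have [int1 ->] := IH (fun Js => f (outcome1 :: Js)) (fun Js => intf _).
have [int2 ->] := IH (fun Js => f (outcome2 :: Js)) (fun Js => intf _).
have intZ (c : R) (g : T -> R) : P.-integrable setT (EFin \o g) ->
    P.-integrable setT (EFin \o (fun w => c * g w)).
  move=> intg; rewrite (_ : _ \o _ = (fun w => c%:E * (g w)%:E)%E).
    exact: integrableZl.
  by apply/funext => w /=; rewrite EFinM.
split.
  rewrite (_ : _ \o _ = (EFin \o (fun w => x * mean_over n x (fun Js => f (outcome1 :: Js) w))%R)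
      \+ (EFin \o (fun w => (1 - x) * mean_over n x (fun Js => f (outcome2 :: Js) w))%R))%E.
    by apply: integrableD => //; exact: intZ.
  by apply/funext => w /=; rewrite EFinD.
rewrite RintegralD //; [|exact: intZ..].
by rewrite !RintegralZl.
Qed.

End MeanOver.

(** * From deterministic rules and stateful learners to the minimax regret *)

Section MinimaxBounds.
Context (R : realType) (Sigma : eqType) (G : game R Sigma 2).
Notation action := 'I_(nact G).+1.
Notation aloss := (@action_loss R Sigma 2 G).

(** Yao's principle: the worst outcome sequence is at least as bad as a random one, and against
    random outcomes a randomized strategy is an average of deterministic rules. A worst regret below
    c would make both means smaller than c. *)
Lemma minimax_regret_ge (n : nat) (x y c : R) : 0 <= x <= 1 -> 0 <= y <= 1 ->
  (forall I, 2 * c <=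
     mean_over n x (@regret _ _ _ G I) + mean_over n y (@regret _ _ _ G I)) ->
  (c%:E <= minimax_regret G n)%E.
Proof.
move=> x01 y01 Hc; apply/ereal_infP => _ [A ->].
rewrite leNgt; apply/negP => ltc.
pose f (Js : seq 'I_2) w := regret ((@select _ _ _ _ A)^~ w) Js.
have intf Js : (rand_prob A).-integrable setT (EFin \o f Js) by exact: integrable_regret.
pose e Js := \int[rand_prob A]_w f Js w.
have eE Js : expected_regret A Js = (e Js)%:E.
  rewrite /expected_regret unlock /e /Rintegral fineK //.
  by apply: (integrable_fin_num _ (intf Js)).
have e_lt Js : size Js = n -> e Js < c.
  move=> /eqP sz; rewrite -lte_fin -eE; apply: le_lt_trans ltc.
  by apply: ereal_sup_ubound; exists (Tuple sz).
have mean_lt z (z01 : 0 <= z <= 1) := mean_over_lt z01 e_lt.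
have [intx meanx] := mean_over_Rintegral n x intf.
have [inty meany] := mean_over_Rintegral n y intf.
have : 2 * c <= mean_over n x e + mean_over n y e.
  rewrite /e meanx meany -RintegralD //.
  have -> : 2 * c = \int[rand_prob A]_w (2 * c).
    rewrite Rintegral_cst // -[LHS]mulr1; congr (_ * _).
    exact: esym (congr1 fine (probability_setT (rand_prob A))).
  apply: le_Rintegral => // [||w _]; last exact: Hc.
    apply: (measurable_bounded_integrable (f := cst (2 * c))) => //.
      exact: le_lt_trans (probability_le1 (rand_prob A) measurableT) (ltry 1).
    by exists `|2 * c|; split=> [|z Cz k _ /=]; [exact: num_real|exact: ltW].
  rewrite (_ : _ \o _ = (EFin \o (fun w => mean_over n x (f^~ w)))
    \+ (EFin \o (fun w => mean_over n y (f^~ w))))%E; first exact: integrableD.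
  by apply/funext => w /=; rewrite EFinD.
have := mean_lt x x01; have := mean_lt y y01; lra.
Qed.

Section Behavioural.
Context (X : Type) (q : X -> action -> R) (upd : X -> action -> Sigma -> X).

(** The expected loss of a behavioural strategy: in state x the action has law [q x], and the
    feedback updates the state. *)
Fixpoint value (x : X) (Js : seq 'I_2) : R :=
  if Js is j :: Js' then
    \sum_a q x a * (loss G a j + value (upd x a (feedback G a j)) Js')
  else 0.

(* A deterministic rule for n rounds: the first action, and the rules followed
   after it according to the outcome that its feedback is attributed to. *)
Fixpoint rule (n : nat) : finType :=
  if n is n'.+1 then (action * (rule n' * rule n'))%type : finType else unit.

(** Feedback other than that of [outcome1] is attributed to [outcome2], so a non-revealing action
    always continues with the first rule. After n rounds [ord0] is a mere default. *)
Fixpoint follow (n : nat) : rule n -> seq Sigma -> action :=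
  if n is n'.+1 then fun w s =>
    if s is sigma :: s' then
      follow (if sigma == feedback G w.1 outcome1 then w.2.1 else w.2.2) s'
    else w.1
  else fun _ _ => ord0.

(** All future decisions are drawn in advance, those of the two continuations independently. *)
Fixpoint rule_prob (n : nat) (x : X) : rule n -> R :=
  if n is n'.+1 then fun w =>
    q x w.1 * (rule_prob (upd x w.1 (feedback G w.1 outcome1)) w.2.1 *
               rule_prob (upd x w.1 (feedback G w.1 outcome2)) w.2.2)
  else fun _ => 1.

Hypotheses (q_ge0 : forall x a, 0 <= q x a) (q_sum1 : forall x, \sum_a q x a = 1).

Lemma rule_prob_ge0 n x (w : rule n) : 0 <= rule_prob x w.
Proof. by elim: n x w => //= n IH x w; rewrite !mulr_ge0. Qed.

Lemma sum_pair (U V : finType) (F : U -> V -> R) :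
  \sum_(w : U * V) F w.1 w.2 = \sum_u \sum_v F u v.
Proof. by rewrite pair_big. Qed.

Lemma rule_prob_sum1 n x : \sum_(w : rule n) rule_prob x w = 1.
Proof.
elim: n x => [|n IH] x /=; first by rewrite big_const card_unit /= addr0.
apply: etrans (sum_pair (fun a (y : rule n * rule n) => q x a *
  (rule_prob (upd x a (feedback G a outcome1)) y.1 *
   rule_prob (upd x a (feedback G a outcome2)) y.2))) _.
rewrite -[RHS](q_sum1 x); apply: eq_bigr => a _.
rewrite -mulr_sumr (sum_pair (fun u v => rule_prob (upd x a (feedback G a outcome1)) u *
   rule_prob (upd x a (feedback G a outcome2)) v)).
by under eq_bigr do rewrite -mulr_sumr IH mulr1; rewrite IH mulr1.
Qed.

(** Drawing decisions in advance does not change the expected loss: only the continuation selected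
    by the feedback matters, and the probabilities of the other one sum to 1. *)
Lemma expected_loss_from n x (Js : seq 'I_2) : size Js = n ->
  \sum_(w : rule n) rule_prob x w * loss_from (follow w) [::] Js = value x Js.
Proof.
elim: n x Js => [|n IH] x [|j Js] //= => [_|[sz]].
  by rewrite big1 // => w _; rewrite /loss_from big_nil mulr0.
pose L a u v := loss G a j + loss_from (follow (n := n.+1) (a, (u, v))) [:: feedback G a j] Js.
transitivity (\sum_a \sum_(y : rule n * rule n) q x a *
  (rule_prob (upd x a (feedback G a outcome1)) y.1 *
   rule_prob (upd x a (feedback G a outcome2)) y.2) * L a y.1 y.2).
  rewrite -sum_pair; apply: eq_bigr => -[a [u v]] _.
  by rewrite loss_from_cons.
apply: eq_bigr => a _; under eq_bigr do rewrite -mulrA; rewrite -mulr_sumr; congr (_ * _).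
rewrite (sum_pair (fun u v => rule_prob (upd x a (feedback G a outcome1)) u *
   rule_prob (upd x a (feedback G a outcome2)) v * L a u v)).
rewrite -(IH _ _ sz) /L.
(* In the first case, which includes a non-revealing action against [outcome2], the second
   continuation sums out. *)
have [eq1|neq1] := eqVneq (feedback G a j) (feedback G a outcome1).
  rewrite eq1 -[loss G a j in RHS]mul1r.
  rewrite -(rule_prob_sum1 n (upd x a (feedback G a outcome1))) mulr_suml -big_split /=.
  apply: eq_bigr => u _; rewrite -mulrDr.
  under eq_bigr do rewrite loss_from_shift /= eqxx mulrAC.
  by rewrite -mulr_sumr rule_prob_sum1 mulr1.
have jE : j = outcome2 by case: (outcome_cases j) neq1 => // ->; rewrite eqxx.
rewrite exchange_big -[loss G a j in RHS]mul1r /=.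
rewrite -(rule_prob_sum1 n (upd x a (feedback G a j))) mulr_suml -big_split /=.
apply: eq_bigr => v _; rewrite -mulrDr.
under eq_bigr do rewrite loss_from_shift /= (negbTE neq1) -mulrA -jE.
by rewrite -mulr_suml rule_prob_sum1 mul1r.
Qed.

Lemma minimax_regret_le_value (x : X) (n : nat) (c : R) :
  (forall Js i, size Js = n -> value x Js - aloss i Js <= c) ->
  (minimax_regret G n <= c%:E)%E.
Proof.
move=> Hc.
have [A AE] := mixed_strategy (@follow n) (@rule_prob_ge0 n x) (rule_prob_sum1 n x).
apply: ge_ereal_inf; exists (worst_regret n A); first by exists A.
apply/ereal_supP => _ [J _ <-]; rewrite AE lee_fin.
have [i bE] := best_loss_attained G J.
rewrite /regret bE; under eq_bigr do rewrite mulrBr.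
rewrite big_split /= sumrN -mulr_suml rule_prob_sum1 mul1r.
by rewrite expected_loss_from ?size_tuple // Hc // size_tuple.
Qed.

End Behavioural.
End MinimaxBounds.
(** * Geometry of two-outcome games *)

(** Putting 1 into the minimum covers the empty family. *)
Lemma pos_lower_bound (R : realType) (I : finType) (P : pred I) (g : I -> R) :
  (forall i, P i -> 0 < g i) ->
  exists e : R, [/\ 0 < e, e <= 1 & forall i, P i -> e <= g i].
Proof.
move=> g_gt0; exists (\big[Num.min/1]_(i | P i) g i); split.
- by apply: lt_bigmin.
- exact: bigmin_le_id.
- by move=> i Pi; exact: bigmin_le_cond.
Qed.

Lemma sum_outcomes (R : realType) (F : 'I_2 -> R) :
  \sum_j F j = F outcome1 + F outcome2.
Proof. by rewrite big_ord_recl big_ord1; congr (_ + F _); exact: val_inj. Qed.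

Section Geometry.
Context (R : realType) (Sigma : eqType) (G : game R Sigma 2).
Notation action := 'I_(nact G).+1.
Implicit Types (i k a b : action) (x : R).

(* A distribution of the outcome is given by the probability x of outcome1. *)
Definition mloss i x : R := loss G i outcome1 * x + loss G i outcome2 * (1 - x).

Lemma mlossE i (p : 'rV[R]_2) : in_simplex p ->
  0 <= p 0 outcome1 <= 1 /\ mean_loss i p = mloss i (p 0 outcome1).
Proof.
move=> [p_ge0]; rewrite sum_outcomes => p_sum1.
have := p_ge0 outcome1; have := p_ge0 outcome2; split; first by lra.
by rewrite /mean_loss sum_outcomes /mloss; congr (_ + _ * _); lra.
Qed.

Lemma mloss_simplex x : 0 <= x <= 1 -> exists p : 'rV[R]_2,
  in_simplex p /\ forall i, mean_loss i p = mloss i x.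
Proof.
move=> x01; pose p := \row_j (if j == outcome1 then x else 1 - x).
have p1 : p 0 outcome1 = x by rewrite mxE eqxx.
have ps : in_simplex p.
  by split=> [j|]; rewrite ?sum_outcomes !mxE //=; [case: ifP => _; lra|lra].
by exists p; split=> // i; rewrite (mlossE i ps).2 p1.
Qed.

Lemma duplicateP i k : reflect
  (loss G i outcome1 = loss G k outcome1 /\ loss G i outcome2 = loss G k outcome2)
  (duplicate i k).
Proof.
apply: (iffP eqP) => [/rowP eq_row|[eq1 eq2]].
  by have := eq_row outcome1; have := eq_row outcome2; rewrite !mxE.
by apply/rowP => j; rewrite !mxE; case: (outcome_cases j) => ->.
Qed.

Lemma duplicate_sym i k : duplicate i k = duplicate k i.
Proof. exact: eq_sym. Qed.

Lemma duplicate_mloss i k x : duplicate i k -> mloss i x = mloss k x.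
Proof. by rewrite /mloss => /duplicateP[-> ->]. Qed.

(** Affine functions that agree at two points have the same coefficients. *)
Lemma mloss_duplicate i k x y : x != y -> mloss i x = mloss k x ->
  mloss i y = mloss k y -> duplicate i k.
Proof.
rewrite /mloss => neq eqx eqy.
have diff : (loss G i outcome1 - loss G k outcome1
   - loss G i outcome2 + loss G k outcome2) * (x - y) = 0 by lra.
have /eqP := diff; rewrite mulf_eq0 [x - y == 0]subr_eq0 (negbTE neq) orbF => /eqP d0.
have d1 : (loss G i outcome1 - loss G k outcome1) * x =
  (loss G i outcome2 - loss G k outcome2) * x by congr (_ * _); lra.
have e2 : loss G i outcome2 = loss G k outcome2 by lra.
apply/duplicateP; split=> //; lra.
Qed.

Lemma nondominatedP i : ~ dominated i <-> exists x, 0 <= x <= 1 /\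
  forall k, ~~ duplicate k i -> mloss i x < mloss k x.
Proof.
split=> [/existsNP[p /not_implyP[ps ndom]]|[x [x01 best]] dom].
  have [p01 mE] := mlossE i ps.
  exists (p 0 outcome1); split=> // k ndup; rewrite ltNge; apply/negP => le_ki.
  by apply: ndom; exists k; split=> //; rewrite (mlossE k ps).2 mE.
have [p [ps pE]] := mloss_simplex x01.
have [k [ndup]] := dom p ps; rewrite !pE leNgt => /negP; apply.
exact: best.
Qed.

Lemma degenerateW i x : dominated i -> 0 <= x <= 1 ->
  (forall k, mloss i x <= mloss k x) -> degenerate i.
Proof.
move=> dom x01 le_ml; split=> //; have [p [ps pE]] := mloss_simplex x01.
by exists p; split=> // k; rewrite !pE.
Qed.

(* Lexicographic minimisation at x and then at another point z: the minimiser is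
   strictly optimal slightly off x in the direction of z. *)
Lemma nondominated_minimizer x : 0 <= x <= 1 ->
  exists k, ~ dominated k /\ forall i, mloss k x <= mloss i x.
Proof.
move=> x01; have [z z01 z_neq] : exists2 z : R, 0 <= z <= 1 & x != z.
  by have [->|] := eqVneq x 1; [exists 0; [lra|exact: oner_neq0]|exists 1 => //; lra].
case: (arg_minP (fun i => mloss i x) (erefl : xpredT (ord0 : action))) => k0 _ min0.
case: (arg_minP (P := fun i => mloss i x == mloss k0 x) (fun i => mloss i z)
  (eqxx (mloss k0 x))) => k /eqP kE mink.
have kx i : mloss k x <= mloss i x by rewrite kE min0.
have kz i : mloss i x = mloss k x -> mloss k z <= mloss i z.
  by move=> iE; apply: mink; rewrite iE kE.
exists k; split=> //; apply/nondominatedP.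
pose g i := mloss i x - mloss k x; pose h i := mloss i z - mloss k z.
(* The choice e (g + |h| + 1) <= g gives (1 - e) g + e h >= e, so positive gaps at x survive the
   move. *)
have [e [e0 e1 eg]] : exists e : R, [/\ 0 < e, e <= 1 &
    forall i, 0 < g i -> e <= g i / (g i + `|h i| + 1)].
  apply: (pos_lower_bound (P := fun i => 0 < g i)) => i gi.
  by rewrite divr_gt0 // -addrA ltr_wpDr // addr_ge0.
exists ((1 - e) * x + e * z); split.
  have : 0 <= (1 - e) * x <= (1 - e) * 1.
    by apply/andP; split; [apply: mulr_ge0|apply: ler_wpM2l]; lra.
  have : 0 <= e * z <= e * 1.
    by apply/andP; split; [apply: mulr_ge0|apply: ler_wpM2l]; lra.
  lra.
move=> i ndup; rewrite -subr_gt0.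
have -> : mloss i ((1 - e) * x + e * z) - mloss k ((1 - e) * x + e * z) =
  (1 - e) * g i + e * h i by rewrite /g /h /mloss; ring.
have [gi|gi] := ltrP 0 (g i).
  have := eg i gi; rewrite ler_pdivlMr; last by rewrite -addrA ltr_wpDr // addr_ge0.
  have : 0 <= e * (h i + `|h i|).
    by apply: mulr_ge0; [exact: ltW|have := ler_norm (- h i); rewrite normrN; lra].
  lra.
have iE : mloss i x = mloss k x by apply/eqP; rewrite eq_le kx -subr_le0 -/(g i) gi.
have h_ge0 : 0 <= h i by rewrite subr_ge0 kz.
have h_neq0 : h i != 0.
  apply: contra ndup; rewrite subr_eq0 => /eqP zE; exact: mloss_duplicate z_neq iE zE.
have h_gt0 : 0 < h i by rewrite lt_neqAle eq_sym h_neq0.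
by rewrite (_ : g i = 0) ?mulr0 ?add0r ?mulr_gt0 // /g iE subrr.
Qed.

(** With n1 and n2 the numbers of the two outcomes, cumulative losses are a multiple of [mloss] at
    the empirical frequency. Hence competing with non-dominated actions suffices. *)
Lemma nondominated_count_minimizer (n1 n2 : R) i : 0 <= n1 -> 0 <= n2 ->
  exists k, ~ dominated k /\
    n1 * loss G k outcome1 + n2 * loss G k outcome2 <=
    n1 * loss G i outcome1 + n2 * loss G i outcome2.
Proof.
move=> n1_ge0 n2_ge0; have [n_gt0|n_le0] := ltrP 0 (n1 + n2).
  have x01 : 0 <= n1 / (n1 + n2) <= 1.
    by rewrite divr_ge0 ?ler_pdivrMr ?mul1r ?lerDl // ltW.
  have [k [ndom le_k]] := nondominated_minimizer x01; exists k; split=> //.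
  have scale m : n1 * loss G m outcome1 + n2 * loss G m outcome2 =
      (n1 + n2) * mloss m (n1 / (n1 + n2)).
    by rewrite /mloss; field; rewrite gt_eqF.
  by rewrite !scale ler_pM2l.
have x01 : 0 <= (0 : R) <= 1 by rewrite lexx ler01.
have [k [ndom _]] := nondominated_minimizer x01; exists k; split=> //.
by have -> : n1 = 0; [lra|]; have -> : n2 = 0; [lra|]; rewrite !mul0r.
Qed.

(** With equal first losses, the action whose second loss is at least as large is nowhere strictly
    better than the other. *)
Lemma nondominated_inj a b : ~ dominated a -> ~ dominated b ->
  loss G a outcome1 = loss G b outcome1 -> duplicate a b.
Proof.
move=> /nondominatedP[x [x01 besta]] /nondominatedP[y [y01 bestb]] eq1.
apply/negPn/negP => ndup.
have := bestb a ndup; rewrite duplicate_sym in ndup; have := besta b ndup.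
rewrite /mloss eq1; set a2 := loss G a outcome2; set b2 := loss G b outcome2 => ? ?.
have [le_ab|lt_ba] := lerP a2 b2.
  have : 0 <= (b2 - a2) * (1 - y) by apply: mulr_ge0; lra.
  lra.
have : 0 <= (a2 - b2) * (1 - x) by apply: mulr_ge0; lra.
lra.
Qed.

(** Let al interpolate the first losses. If r were on or above the chord in the second loss, mixing
    s and m would be no worse than r even where r is strictly optimal. *)
Lemma nondominated_between s r m : ~ dominated r ->
  loss G s outcome1 < loss G r outcome1 < loss G m outcome1 ->
  exists al : R, [/\ 0 < al < 1,
    loss G r outcome1 = al * loss G s outcome1 + (1 - al) * loss G m outcome1 &
    loss G r outcome2 < al * loss G s outcome2 + (1 - al) * loss G m outcome2].
Proof.
move=> /nondominatedP[x [x01 best]] /andP[sr rm].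
have best_s : mloss r x < mloss s x.
  by apply: best; apply/duplicateP => -[eq1 _]; rewrite eq1 ltxx in sr.
have best_m : mloss r x < mloss m x.
  by apply: best; apply/duplicateP => -[eq1 _]; rewrite eq1 ltxx in rm.
set s1 := loss G s outcome1 in sr *; set r1 := loss G r outcome1 in sr rm *.
set m1 := loss G m outcome1 in rm *.
pose al := (m1 - r1) / (m1 - s1).
have al01 : 0 < al < 1 by rewrite divr_gt0 ?ltr_pdivrMr; lra.
have r1E : r1 = al * s1 + (1 - al) * m1.
  by rewrite /al; field; rewrite gt_eqF //; lra.
exists al; split=> //; rewrite ltNge; apply/negP => le2.
move: best_s best_m; rewrite /mloss -/s1 -/r1 -/m1 => best_s best_m.
set s2 := loss G s outcome2 in best_s le2; set r2 := loss G r outcome2 in best_s best_m le2.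
set m2 := loss G m outcome2 in best_m le2.
have mix : r1 * x + r2 * (1 - x) <
    al * (s1 * x + s2 * (1 - x)) + (1 - al) * (m1 * x + m2 * (1 - x)).
  have : 0 < al * (s1 * x + s2 * (1 - x) - (r1 * x + r2 * (1 - x))) by apply: mulr_gt0; lra.
  have : 0 < (1 - al) * (m1 * x + m2 * (1 - x) - (r1 * x + r2 * (1 - x))) by apply: mulr_gt0; lra.
  lra.
have : (al * s2 + (1 - al) * m2) * (1 - x) <= r2 * (1 - x) by apply: ler_wpM2r => //; lra.
have : r1 * x = (al * s1 + (1 - al) * m1) * x by rewrite -r1E.
lra.
Qed.

(** The actions a and b change order between their points of strict optimality, hence tie at some x.
    A non-dominated action further out is strictly worse at x, because a or b lies strictly below
    the chord joining it to the other one. *)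
Lemma consecutive_tie a b : ~ dominated a -> ~ dominated b ->
  loss G a outcome1 < loss G b outcome1 ->
  (forall i, ~ dominated i ->
    loss G i outcome1 <= loss G a outcome1 \/ loss G b outcome1 <= loss G i outcome1) ->
  exists x, [/\ 0 < x < 1, mloss a x = mloss b x, forall i, mloss a x <= mloss i x &
    forall i, ~ dominated i -> mloss i x = mloss a x -> duplicate i a \/ duplicate i b].
Proof.
move=> nda ndb ab consec.
have [[xa [xa01 besta]] [xb [xb01 bestb]]] := ((nondominatedP a).1 nda, (nondominatedP b).1 ndb).
have ndup : ~~ duplicate b a by apply/duplicateP => -[eq1 _]; rewrite eq1 ltxx in ab.
pose D x := mloss b x - mloss a x.
have Da : 0 < D xa by rewrite subr_gt0 besta.
have Db : D xb < 0 by rewrite subr_lt0 bestb // duplicate_sym.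
pose t := D xa / (D xa - D xb); pose x := (1 - t) * xa + t * xb.
have t01 : 0 < t < 1 by rewrite divr_gt0 ?ltr_pdivrMr; lra.
have Dx : D x = 0.
  have -> : D x = (1 - t) * D xa + t * D xb by rewrite /D /x /mloss; ring.
  by rewrite /t; field; rewrite gt_eqF //; lra.
have tie : mloss a x = mloss b x by apply/eqP; rewrite eq_sym -subr_eq0 -/(D x) Dx.
have xab : xa != xb by apply/eqP => eqx; move: Da Db; rewrite eqx; lra.
have x01 : 0 < x < 1.
  have -> : x = xa + t * (xb - xa) by rewrite /x; ring.
  case/orP: (lt_total xab) => ltx.
    have : 0 < t * (xb - xa) < 1 * (xb - xa).
      by apply/andP; split; [apply: mulr_gt0|rewrite ltr_pM2r]; lra.
    lra.
  have : 0 < t * (xa - xb) < 1 * (xa - xb).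
    by apply/andP; split; [apply: mulr_gt0|rewrite ltr_pM2r]; lra.
  lra.
have chord r s m (al : R) :
    loss G r outcome1 = al * loss G s outcome1 + (1 - al) * loss G m outcome1 ->
    loss G r outcome2 < al * loss G s outcome2 + (1 - al) * loss G m outcome2 ->
    mloss r x < al * mloss s x + (1 - al) * mloss m x.
  move=> eq1 lt2; rewrite -subr_gt0 /mloss eq1.
  have : 0 < (al * loss G s outcome2 + (1 - al) * loss G m outcome2 - loss G r outcome2) * (1 - x).
    by apply: mulr_gt0; lra.
  lra.
have strict i : ~ dominated i -> ~~ duplicate i a -> ~~ duplicate i b ->
    mloss a x < mloss i x.
  move=> ndi nia nib; case: (consec i ndi).
    rewrite le_eqVlt => /predU1P[/(nondominated_inj ndi nda)|ia]; first by rewrite (negbTE nia).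
    have iab : loss G i outcome1 < loss G a outcome1 < loss G b outcome1 by rewrite ia.
    have [al [al01 eq1 lt2]] := nondominated_between nda iab.
    have : mloss a x < al * mloss i x + (1 - al) * mloss b x by exact: chord eq1 lt2.
    rewrite -tie => lt_mix; have : 0 < al * (mloss i x - mloss a x) by lra.
    by rewrite pmulr_rgt0 ?subr_gt0; lra.
  rewrite le_eqVlt => /predU1P[/esym/(nondominated_inj ndi ndb)|bi]; first by rewrite (negbTE nib).
  have abi : loss G a outcome1 < loss G b outcome1 < loss G i outcome1 by rewrite ab.
  have [al [al01 eq1 lt2]] := nondominated_between ndb abi.
  have : mloss b x < al * mloss a x + (1 - al) * mloss i x by exact: chord eq1 lt2.
  rewrite -tie => lt_mix; have : 0 < (1 - al) * (mloss i x - mloss a x) by lra.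
  by rewrite pmulr_rgt0 ?subr_gt0; lra.
exists x; split=> // [i|i ndi ix].
  have x01w : 0 <= x <= 1 by lra.
  have [k [ndk /(_ i)]] := nondominated_minimizer x01w; apply: le_trans.
  have [ka|nka] := boolP (duplicate k a); first by rewrite (duplicate_mloss _ ka).
  have [kb|nkb] := boolP (duplicate k b); first by rewrite (duplicate_mloss _ kb) tie.
  by rewrite ltW // strict.
have [ia|nia] := boolP (duplicate i a); first by left.
have [ib|nib] := boolP (duplicate i b); first by right.
by have := strict i ndi nia nib; rewrite ix ltxx.
Qed.

End Geometry.

(** * Removal of duplicates and the chain of non-dominated actions *)

Section Deduplication.
Context (R : realType) (Sigma : eqType).
Implicit Types G : game R Sigma 2.

Lemma duplicates_removed_exists G : exists G', duplicates_removed G G'.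
Proof.
pose act := 'I_(nact G).+1.
(* A representative that depends only on the duplicate class of i and is revealing if possible. The
   inner default i is never reached, since i lies in its own class. *)
pose keep (i : act) : act :=
  odflt (odflt i [pick i' | duplicate i' i]) [pick i' | duplicate i' i && revealing i'].
have keep_dup i : duplicate (keep i) i.
  rewrite /keep; case: (pickP (fun i' => _ && _)) => [i' /andP[]|_] //=.
  by case: pickP => [i'|_] //=; exact: eqxx.
have keep_rev k i : duplicate (keep k) i -> revealing i -> revealing (keep k).
  move=> ki irev; rewrite /keep; case: (pickP (fun i' => _ && _)) => [i' /andP[]|/(_ i)] //=.
  by rewrite irev andbT duplicate_sym /duplicate -(eqP (keep_dup k)) => /negP[].
have keep_eq i i' : duplicate i i' -> keep i = keep i'.
  move=> ii'; have dupE k : duplicate k i = duplicate k i' by rewrite /duplicate (eqP ii').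
  have revE k : duplicate k i && revealing k = duplicate k i' && revealing k by rewrite dupE.
  rewrite /keep (eq_pick revE) (eq_pick dupE); congr odflt.
  by case: (pickP (fun k => duplicate k i')) => //= /(_ i'); rewrite /duplicate eqxx.
have keepK i : keep (keep i) = keep i by exact/keep_eq/keep_dup.
pose reps := undup [seq keep i | i <- enum act].
have keep_reps i : keep i \in reps by rewrite mem_undup map_f // mem_enum.
have size_reps : (size reps).-1.+1 = size reps.
  by rewrite prednK //; have := keep_reps ord0; case: (reps).
pose f (k : 'I_(size reps).-1.+1) : act := nth ord0 reps k.
have f_reps k : f k \in reps by rewrite mem_nth // -[X in (_ < X)%N]size_reps ltn_ord.
have f_keep k : keep (f k) = f k.
  by have := f_reps k; rewrite mem_undup => /mapP[i _ ->]; exact: keepK.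
exists (@Game R Sigma 2 (size reps).-1 (rowsub f (loss G)) (rowsub f (feedback G))).
exists f; split=> //=.
- move=> k k' /keep_eq; rewrite !f_keep /f => /eqP.
  rewrite nth_uniq ?undup_uniq -?[X in (_ < X)%N]size_reps ?ltn_ord //.
  by move=> /eqP; exact: val_inj.
- move=> i; have lt : (index (keep i) reps < (size reps).-1.+1)%N.
    by rewrite size_reps index_mem.
  by exists (Ordinal lt); rewrite /f /= nth_index.
- by move=> k i; rewrite -f_keep; exact: keep_rev.
Qed.

Section Removed.
Context (G G' : game R Sigma 2).
Variable f : 'I_(nact G').+1 -> 'I_(nact G).+1.
Hypotheses (lossE : loss G' = rowsub f (loss G))
  (feedbackE : feedback G' = rowsub f (feedback G))
  (f_inj : forall k k', duplicate (f k) (f k') -> k = k')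
  (f_onto : forall i, exists k, duplicate (f k) i).

Lemma revealing_removed k : revealing k = revealing (f k).
Proof. by rewrite /revealing feedbackE !mxE. Qed.

Lemma loss_removed k j : loss G' k j = loss G (f k) j.
Proof. by rewrite lossE mxE. Qed.

Lemma duplicate_removed k k' : duplicate k k' = duplicate (f k) (f k').
Proof. by apply/duplicateP/duplicateP; rewrite !loss_removed. Qed.

Lemma mloss_removed k x : mloss k x = mloss (f k) x.
Proof. by rewrite /mloss !loss_removed. Qed.

(** Every action of G duplicates a kept one, so strict optimality up to duplicates means the same in
    both games. *)
Lemma nondominated_removed k : ~ dominated k <-> ~ dominated (f k).
Proof.
rewrite !nondominatedP; split=> -[x [x01 best]]; exists x; split=> // i ndup.
  have [k' k'i] := f_onto i.
  rewrite -(duplicate_mloss _ k'i) -!mloss_removed; apply: best.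
  by apply: contra ndup; rewrite duplicate_removed /duplicate (eqP k'i).
by rewrite !mloss_removed; apply: best; rewrite -duplicate_removed.
Qed.

Lemma mem_chain k : k \in chain G' <-> ~ dominated (f k).
Proof.
rewrite mem_sort mem_filter mem_enum andbT -nondominated_removed.
by split=> [/negP dom /asboolP|dom]; last by apply/negP => /asboolP.
Qed.

Lemma chain_uniq : uniq (chain G').
Proof. by rewrite sort_uniq filter_uniq ?enum_uniq. Qed.

Notation link n := (f (nth ord0 (chain G') n)).

Lemma chain_nondominated n : (n < size (chain G'))%N -> ~ dominated (link n).
Proof. by move=> lt; apply/mem_chain; rewrite mem_nth. Qed.

Lemma chain_index i : ~ dominated i -> exists n,
  (n < size (chain G'))%N /\ duplicate (link n) i.
Proof.
move=> ndi; have [k ki] := f_onto i; have kc : k \in chain G'.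
  apply/mem_chain => dom; apply: ndi => p ps; have [i' [ndup le]] := dom p ps.
  exists i'; move: ndup le; rewrite /duplicate -(eqP ki); split=> //.
  have [p01 E] := mlossE i ps; rewrite E -(duplicate_mloss _ ki).
  by rewrite -(mlossE (f k) ps).2.
by exists (index k (chain G')); rewrite index_mem nth_index.
Qed.

(** Sorting gives the weak inequality. Equality would make the two non-dominated actions duplicates,
    hence one and the same entry of the chain. *)
Lemma chain_lt n n' : (n < n')%N -> (n' < size (chain G'))%N ->
  loss G (link n) outcome1 < loss G (link n') outcome1.
Proof.
move=> nn' lt'; have lt := ltn_trans nn' lt'.
rewrite lt_neqAle; apply/andP; split.
  apply/eqP => /(nondominated_inj (chain_nondominated lt) (chain_nondominated lt')) /f_inj /eqP.
  by rewrite nth_uniq ?chain_uniq // ltn_eqF.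
rewrite -!loss_removed.
have total : total (fun i i' : 'I_(nact G').+1 => loss G' i outcome1 <= loss G' i' outcome1).
  by move=> ? ?; exact: le_total.
have trans : transitive (fun i i' : 'I_(nact G').+1 => loss G' i outcome1 <= loss G' i' outcome1).
  by move=> ? ? ?; exact: le_trans.
by apply: (sorted_ltn_nth trans ord0 (sort_sorted total _)).
Qed.

Lemma chain_consecutive n i : (n.+1 < size (chain G'))%N -> ~ dominated i ->
  loss G i outcome1 <= loss G (link n) outcome1 \/
  loss G (link n.+1) outcome1 <= loss G i outcome1.
Proof.
move=> lt ndi; have [m [ltm mi]] := chain_index ndi.
have -> : loss G i outcome1 = loss G (link m) outcome1.
  by have /duplicateP[->] := mi.
have [|] := leqP m n; rewrite leq_eqVlt => /predU1P[->|mn]; [by left| |by right|].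
  by left; rewrite ltW // chain_lt // (ltn_trans _ lt).
by right; rewrite ltW // chain_lt.
Qed.

Lemma chain_tie n : (n.+1 < size (chain G'))%N ->
  exists x : R, [/\ 0 < x < 1, mloss (link n) x = mloss (link n.+1) x,
    forall i : 'I_(nact G).+1, mloss (link n) x <= mloss i x &
    forall i : 'I_(nact G).+1, ~ dominated i -> mloss i x = mloss (link n) x ->
      duplicate i (link n) \/ duplicate i (link n.+1)].
Proof.
move=> lt; have lt0 := ltn_trans (ltnSn n) lt.
apply: consecutive_tie; [exact: chain_nondominated..|exact: chain_lt|].
by move=> i; exact: chain_consecutive.
Qed.

(** The successor of position n is revealing, hence differs from position n' and lies strictly
    between the two, below their chord. *)
Lemma chain_separated n n' :
    sorted (fun i i' => revealing i || revealing i') (chain G') ->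
    (n < n')%N -> (n' < size (chain G'))%N ->
    ~~ revealing (link n) -> ~~ revealing (link n') ->
  exists r (al : R), [/\ revealing r, 0 <= al <= 1 &
    forall j, loss G r j <= al * loss G (link n) j + (1 - al) * loss G (link n') j].
Proof.
move=> /(sortedP ord0) sep nn' lt' nrev nrev'.
have lt := leq_ltn_trans nn' lt'.
have rev1 : revealing (link n.+1).
  by have := sep n lt; rewrite !revealing_removed (negbTE nrev).
have n1n' : (n.+1 < n')%N.
  by rewrite ltn_neqAle nn' andbT; apply/eqP => eqn; rewrite eqn (negbTE nrev') in rev1.
have between : loss G (link n) outcome1 < loss G (link n.+1) outcome1 < loss G (link n') outcome1.
  by rewrite !chain_lt.
have [al [al01 eq1 lt2]] := nondominated_between (chain_nondominated lt) between.
exists (link n.+1), al; split=> // [|j]; first by lra.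
by case: (outcome_cases j) => ->; [rewrite eq1|exact: ltW].
Qed.

Lemma chain_size_ge2 (i k : 'I_(nact G).+1) : ~ dominated i -> ~ dominated k -> ~~ duplicate i k ->
  (1 < size (chain G'))%N.
Proof.
move=> /chain_index[n [ltn ni]] /chain_index[m [ltm mk]] ndup.
suff : n != m by lia.
by apply: contra ndup => /eqP nm; rewrite duplicate_sym in ni; rewrite /duplicate (eqP ni) nm.
Qed.

End Removed.

Lemma row_nondominated G (a : 'I_(nact G).+1) : ~ dominated a ->
  row a (loss G) \in undup [seq row i (loss G) | i <- nondominated_actions G].
Proof.
move=> nda; rewrite mem_undup; apply: (map_f (fun i => row i (loss G))).
by rewrite mem_filter mem_enum andbT; apply/negP => /asboolP.
Qed.

Lemma num_nondominated_gt0 G : (0 < num_nondominated G)%N.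
Proof.
have x01 : 0 <= (0 : R) <= 1 by rewrite lexx ler01.
have [k [ndk _]] := nondominated_minimizer G x01.
by have := row_nondominated ndk; rewrite /num_nondominated; case: undup.
Qed.

Lemma num_nondominated1 G (i k : 'I_(nact G).+1) : num_nondominated G = 1%N ->
  ~ dominated i -> ~ dominated k -> duplicate i k.
Proof.
rewrite /num_nondominated => s1 /row_nondominated + /row_nondominated.
case: undup s1 => [|r [|//]] // _.
by rewrite !inE /duplicate => /eqP-> /eqP->.
Qed.

Lemma num_nondominated_ge2 G : (2 <= num_nondominated G)%N ->
  exists i k : 'I_(nact G).+1, [/\ ~ dominated i, ~ dominated k & ~~ duplicate i k].
Proof.
rewrite /num_nondominated; set s := undup _ => s2.
have s_mem r : r \in s -> exists2 a : 'I_(nact G).+1, ~ dominated a & r = row a (loss G).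
  rewrite mem_undup => /mapP[a]; rewrite mem_filter => /andP[/negP dom _] ->.
  by exists a => // /asboolP.
have := undup_uniq [seq row i (loss G) | i <- nondominated_actions G]; rewrite -/s.
case: s s2 s_mem => [|r [|r' s]] // _ s_mem.
have [a nda ->] := s_mem r (mem_head _ _).
have [|b ndb ->] := s_mem r'; first by rewrite !inE eqxx orbT.
by rewrite /= inE negb_or => /andP[/andP[ndup _] _]; exists a, b.
Qed.

End Deduplication.
(** * Lower bounds *)

Section Harmonic.
Context (R : realType).
Implicit Types u v x y mu : R.

Definition harmonic u v : R := u * v / (u + v).

(** After multiplication by u + v the difference of the two sides is g u^2 + g' v^2. *)
Lemma harmonic_le u v (g g' : R) : 0 < u -> 0 < v -> 0 <= g -> 0 <= g' ->
  (g + g') * harmonic u v <= u * g + v * g'.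
Proof.
move=> u0 v0 g0 g'0; rewrite /harmonic mulrA ler_pdivrMr ?addr_gt0 //.
have : 0 <= g * (u * u) by rewrite !mulr_ge0 // ltW.
have : 0 <= g' * (v * v) by rewrite !mulr_ge0 // ltW.
lra.
Qed.

Lemma harmonic_le_sum u v : 0 < u -> 0 < v -> harmonic u v <= u + v.
Proof.
move=> u0 v0; rewrite /harmonic ler_pdivrMr ?addr_gt0 //.
have := mulr_gt0 u0 v0; have := mulr_gt0 u0 u0; have := mulr_gt0 v0 v0; lra.
Qed.

Lemma harmonic_ge0 u v : 0 < u -> 0 < v -> 0 <= harmonic u v.
Proof. by move=> u0 v0; rewrite divr_ge0 ?mulr_ge0 ?addr_ge0 // ltW. Qed.

(* The information on which of the two environments is the true one that a
   single outcome reveals is of second order in x - y. *)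
Lemma harmonic_split u v x y mu : 0 < u -> 0 < v -> 0 < mu ->
    mu <= x <= 1 - mu -> mu <= y <= 1 - mu ->
  harmonic u v - harmonic (u * x) (v * y) - harmonic (u * (1 - x)) (v * (1 - y)) <=
  (x - y) ^+ 2 / mu ^+ 2 * (u + v).
Proof.
move=> u0 v0 mu0 xmu ymu.
have uv0 : 0 < u + v by rewrite addr_gt0.
have d1 : 0 < mu * (u + v) <= u * x + v * y.
  rewrite mulr_gt0 //=; have : u * mu <= u * x by apply: ler_wpM2l; lra.
  have : v * mu <= v * y by apply: ler_wpM2l; lra.
  lra.
have d2 : mu * (u + v) <= u * (1 - x) + v * (1 - y).
  have : u * mu <= u * (1 - x) by apply: ler_wpM2l; lra.
  have : v * mu <= v * (1 - y) by apply: ler_wpM2l; lra.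
  lra.
move/andP: d1 => [d0 d1]; have d1' := lt_le_trans d0 d1; have d2' := lt_le_trans d0 d2.
(* The decrease is an exact square over the three denominators, two of which are at least mu (u +
   v). *)
have -> : harmonic u v - harmonic (u * x) (v * y) - harmonic (u * (1 - x)) (v * (1 - y)) =
    (u * v * (x - y)) ^+ 2 / ((u * x + v * y) * (u * (1 - x) + v * (1 - y)) * (u + v)).
  by rewrite /harmonic; field; rewrite !gt_eqF.
rewrite ler_pdivrMr; last by rewrite !mulr_gt0.
have le_d : (mu * (u + v)) * (mu * (u + v)) <= (u * x + v * y) * (u * (1 - x) + v * (1 - y)).
  by apply: ler_pM => //; exact: ltW.
have le_uv : u * v <= (u + v) * (u + v).
  by have := mulr_gt0 u0 v0; have := mulr_gt0 u0 u0; have := mulr_gt0 v0 v0; lra.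
have le_uv2 : (u * v) ^+ 2 <= ((u + v) * (u + v)) ^+ 2.
  by rewrite ler_pXn2r // ?nnegrE ?mulr_ge0 // ltW.
have -> : (u * v * (x - y)) ^+ 2 = (x - y) ^+ 2 * (u * v) ^+ 2 by rewrite exprMn mulrC.
have -> : (x - y) ^+ 2 / mu ^+ 2 * (u + v) *
    ((u * x + v * y) * (u * (1 - x) + v * (1 - y)) * (u + v)) =
  (x - y) ^+ 2 * (((u * x + v * y) * (u * (1 - x) + v * (1 - y))) / mu ^+ 2 * (u + v) ^+ 2).
  by field; rewrite gt_eqF.
apply: ler_wpM2l; first exact: sqr_ge0.
apply: le_trans le_uv2 _.
have -> : ((u + v) * (u + v)) ^+ 2 = (mu * (u + v)) * (mu * (u + v)) / mu ^+ 2 * (u + v) ^+ 2.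
  by field; rewrite gt_eqF.
by apply: ler_wpM2r; [exact: sqr_ge0|apply: ler_wpM2r; rewrite ?invr_ge0 ?sqr_ge0].
Qed.

End Harmonic.

(** * Regret summed over two environments *)

Section LowerBound.
Context (R : realType) (Sigma : eqType) (G : game R Sigma 2).
Notation action := 'I_(nact G).+1.
Notation aloss := (@action_loss R Sigma 2 G).
Implicit Types (I : seq Sigma -> action) (s : seq Sigma) (i a b : action) (x y : R).

(** For empty [s] this is at most the mean of the true regret, since the comparison is with a fixed
    action. *)
Definition mean_regret n I s a x : R :=
  mean_over n x (fun Js => loss_from I s Js - aloss a Js).

Lemma mean_regretS n I s a x : mean_regret n.+1 I s a x =
  (mloss (I s) x - mloss a x) +
  (x * mean_regret n I (rcons s (feedback G (I s) outcome1)) a x +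
   (1 - x) * mean_regret n I (rcons s (feedback G (I s) outcome2)) a x).
Proof.
have step j : mean_over n x (fun Js => loss_from I s (j :: Js) - aloss a (j :: Js)) =
    loss G (I s) j - loss G a j + mean_regret n I (rcons s (feedback G (I s) j)) a x.
  rewrite -mean_overDl; congr mean_over; apply/funext => Js.
  by rewrite loss_from_cons /action_loss big_cons; ring.
rewrite {1}/mean_regret /= !step /mloss; ring.
Qed.

Section TwoEnvironments.
Variables (a b : action) (x y al be : R) (T : nat).
Let gap1 i := mloss i x - mloss a x.
Let gap2 i := mloss i y - mloss b y.
Hypothesis be_ge0 : 0 <= be.
Hypotheses (gap1_ge0 : forall i, 0 <= gap1 i) (gap2_ge0 : forall i, 0 <= gap2 i).
Hypothesis gap_ge : forall i, al <= gap1 i + gap2 i.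
Hypothesis revealing_cost : forall i, revealing i -> [/\ 0 < x < 1, 0 < y < 1 &
  forall n u v, (n < T)%N -> 0 < u -> 0 < v ->
  al * harmonic u v + n%:R * (al * (harmonic u v - harmonic (u * x) (v * y) -
     harmonic (u * (1 - x)) (v * (1 - y)))) <=
  u * gap1 i + v * gap2 i + be * (u + v)].

(** Induction on the remaining rounds. After a non-revealing action both outcomes lead to the same
    history, so u and v stay as they are. After a revealing one they split, and [revealing_cost] is
    exactly the inequality that closes the step. *)
Lemma two_environments n I s u v : (n <= T)%N -> 0 < u -> 0 < v ->
  n%:R * (al * harmonic u v - be * (u + v)) <=
  u * mean_regret n I s a x + v * mean_regret n I s b y.
Proof.
elim: n s u v => [|n IH] s u v nT u0 v0.
  by rewrite mul0r /mean_regret /= /loss_from /action_loss !big_nil subrr !mulr0 addr0.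
rewrite !mean_regretS -/(gap1 _) -/(gap2 _) -natr1.
have [rev|nrev] := boolP (revealing (I s)).
  have [x01 y01 cost] := revealing_cost rev.
  have := cost n u v nT u0 v0.
  have ux0 : 0 < u * x by apply: mulr_gt0; lra.
  have vy0 : 0 < v * y by apply: mulr_gt0; lra.
  have ux1 : 0 < u * (1 - x) by apply: mulr_gt0; lra.
  have vy1 : 0 < v * (1 - y) by apply: mulr_gt0; lra.
  have := IH (rcons s (feedback G (I s) outcome1)) _ _ (ltnW nT) ux0 vy0.
  have := IH (rcons s (feedback G (I s) outcome2)) _ _ (ltnW nT) ux1 vy1.
  set h := harmonic u v; set h1 := harmonic (u * x) _; set h2 := harmonic (u * (1 - x)) _.
  move: (n%:R) => nR; lra.
move/negPn/eqP: nrev => <-.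
have := IH (rcons s (feedback G (I s) outcome1)) _ _ (ltnW nT) u0 v0.
have : al * harmonic u v <= (gap1 (I s) + gap2 (I s)) * harmonic u v.
  by apply: ler_wpM2r; [exact: harmonic_ge0|exact: gap_ge].
have := harmonic_le u0 v0 (gap1_ge0 (I s)) (gap2_ge0 (I s)).
have : 0 <= be * (u + v) by rewrite mulr_ge0 // addr_ge0 // ltW.
move: (n%:R) => nR; lra.
Qed.

Lemma minimax_regret_two_environments : 0 <= x <= 1 -> 0 <= y <= 1 ->
  ((T%:R * (al / 4 - be))%:E <= minimax_regret G T)%E.
Proof.
move=> x01 y01; apply: (minimax_regret_ge x01 y01) => I.
have regret_ge i z : 0 <= z <= 1 -> mean_regret T I [::] i z <= mean_over T z (@regret _ _ _ G I).
  move=> z01; apply: ler_mean_over => // Js _.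
  by rewrite lerD2l lerN2; exact: best_loss_le.
have := regret_ge a x x01; have := regret_ge b y y01.
have := @two_environments T I [::] 1 1 (leqnn T) ltr01 ltr01.
(* Before the first round u = v = 1. Halving the sum of the two regrets turns al / 2 - 2 be into al
   / 4 - be. *)
rewrite (_ : harmonic 1 1 = 1 / 2); last by rewrite /harmonic mulr1.
move: (T%:R) => TR; lra.
Qed.

End TwoEnvironments.
End LowerBound.

(** * The rates of the lower bounds *)

Section LowerBounds.
Context (R : realType) (Sigma : eqType) (G : game R Sigma 2).
Notation action := 'I_(nact G).+1.
Implicit Types (i a b : action) (x y : R).

(** Two identical environments, with al = be = 0. *)
Lemma minimax_regret_ge0 T : (0 <= minimax_regret G T)%E.
Proof.
have x01 : 0 <= (1 / 2 : R) <= 1 by lra.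
have [k [_ min_k]] := nondominated_minimizer G x01.
have gap_ge0 i : 0 <= mloss i (1 / 2) - mloss k (1 / 2) by rewrite subr_ge0.
have := @minimax_regret_two_environments _ _ G k k (1 / 2) (1 / 2) 0 0 T (lexx _)
  gap_ge0 gap_ge0 _ _ x01 x01.
rewrite mul0r subrr mulr0; apply=> i; first by rewrite addr_ge0.
move=> _; split; [lra..|] => n u v _ u0 v0.
by rewrite !mul0r mulr0 !addr0 addr_ge0 // mulr_ge0 // ltW.
Qed.

(* The environments are obtained by moving from the tie x0 towards points where
   a, respectively b, is strictly optimal. *)
Lemma tie_environments a b x0 : ~ dominated a -> ~ dominated b ->
    ~~ duplicate a b -> 0 < x0 < 1 -> mloss a x0 = mloss b x0 ->
    (forall i, mloss a x0 <= mloss i x0) ->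
  exists kappa mu : R, [/\ 0 < kappa, 0 < mu <= 1 / 2 &
    forall th : R, 0 <= th <= 1 / 2 -> exists x y,
    [/\ mu <= x <= 1 - mu, mu <= y <= 1 - mu, (x - y) ^+ 2 <= th ^+ 2,
     forall i, (mloss i x0 - mloss a x0) / 2 <= mloss i x - mloss a x /\
               (mloss i x0 - mloss a x0) / 2 <= mloss i y - mloss b y &
     forall i, kappa * th <= (mloss i x - mloss a x) + (mloss i y - mloss b y)]].
Proof.
move=> /nondominatedP[xa [xa01 besta]] /nondominatedP[xb [xb01 bestb]] ndup x001 tie min0.
pose h1 i := mloss i xa - mloss a xa; pose h2 i := mloss i xb - mloss b xb.
have h1_ge0 i : 0 <= h1 i.
  rewrite subr_ge0; have [ia|nia] := boolP (duplicate i a); last exact/ltW/besta.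
  by rewrite (duplicate_mloss _ ia).
have h2_ge0 i : 0 <= h2 i.
  rewrite subr_ge0; have [ib|nib] := boolP (duplicate i b); last exact/ltW/bestb.
  by rewrite (duplicate_mloss _ ib).
(* No action duplicates both a and b, so each is suboptimal at xa or at xb. *)
have h_gt0 i : 0 < h1 i + h2 i.
  have [ia|nia] := boolP (duplicate i a).
    rewrite ltr_wpDl // subr_gt0 bestb //.
    by apply: contra ndup => ib; rewrite duplicate_sym in ia; rewrite /duplicate (eqP ia).
  by rewrite ltr_pwDl // subr_gt0 besta.
have [kappa [kappa0 _ kappa_le]] := pos_lower_bound (P := xpredT) (fun i _ => h_gt0 i).
(* A move by th <= 1/2 keeps at least half of the distance of x0 to 0 and to 1. *)
have [mu [mu0 _ mu_le]] : exists e : R, [/\ 0 < e, e <= 1 &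
    forall c : bool, true -> e <= (if c then x0 else 1 - x0) / 2].
  by apply: (pos_lower_bound (P := xpredT)) => -[] _; lra.
have mu1 : mu <= x0 / 2 := mu_le true isT.
have mu2 : mu <= (1 - x0) / 2 := mu_le false isT.
exists kappa, mu; split; [exact: kappa0|lra|] => th th01.
pose x := (1 - th) * x0 + th * xa; pose y := (1 - th) * x0 + th * xb.
have x_gap i : mloss i x - mloss a x = (1 - th) * (mloss i x0 - mloss a x0) + th * h1 i.
  by rewrite /x /h1 /mloss; ring.
have y_gap i : mloss i y - mloss b y = (1 - th) * (mloss i x0 - mloss a x0) + th * h2 i.
  by rewrite tie /y /h2 /mloss; ring.
have in_mu z : 0 <= z <= 1 -> mu <= (1 - th) * x0 + th * z <= 1 - mu.
  move=> z01; have : 0 <= th * z <= th * 1.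
    by apply/andP; split; [apply: mulr_ge0|apply: ler_wpM2l]; lra.
  have : th * x0 <= 1 / 2 * x0 by apply: ler_wpM2r; lra.
  have : th * (1 - x0) <= 1 / 2 * (1 - x0) by apply: ler_wpM2r; lra.
  lra.
have g_ge0 i : 0 <= mloss i x0 - mloss a x0 by rewrite subr_ge0.
have half_le i : (mloss i x0 - mloss a x0) / 2 <= (1 - th) * (mloss i x0 - mloss a x0).
  by rewrite mulrC; apply: ler_wpM2r => //; lra.
exists x, y; split=> [| |||i].
- exact: in_mu.
- exact: in_mu.
- have -> : x - y = th * (xa - xb) by rewrite /x /y; ring.
  rewrite exprMn ler_piMr ?sqr_ge0 // expr2.
  have : 0 <= (1 - (xa - xb)) * (1 + (xa - xb)) by apply: mulr_ge0; lra.
  lra.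
- move=> i; rewrite x_gap y_gap; split.
    by rewrite (le_trans (half_le i)) // lerDl mulr_ge0 //; lra.
  by rewrite (le_trans (half_le i)) // lerDl mulr_ge0 //; lra.
- rewrite x_gap y_gap.
  have := mulr_ge0 (_ : 0 <= 1 - th) (g_ge0 i).
  have : th * kappa <= th * (h1 i + h2 i) by apply: ler_wpM2l; [lra|exact: kappa_le].
  by move=> ? /(_ ltac:(lra)) ?; lra.
Qed.

Section Tie.
Variables (a b : action) (x0 : R).
Hypotheses (nda : ~ dominated a) (ndb : ~ dominated b) (ndup : ~~ duplicate a b)
  (x001 : 0 < x0 < 1) (tie : mloss a x0 = mloss b x0)
  (min0 : forall i, mloss a x0 <= mloss i x0).

(** The decrease of [harmonic] caused by revealing actions is charged to [be], which stays below al
    / 16 and leaves 3 al / 16 per round. *)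
Lemma minimax_regret_sqrt_ge : exists2 c : R, 0 < c &
  forall T, (0 < T)%N -> ((c * Num.sqrt T%:R)%:E <= minimax_regret G T)%E.
Proof.
have [kappa [mu [kappa0 mu01 envs]]] := tie_environments nda ndb ndup x001 tie min0.
have /andP[mu0 mu1] := mu01.
exists (kappa * mu / 32); first by rewrite divr_gt0 ?mulr_gt0.
move=> T T0; pose z : R := Num.sqrt T%:R.
have T1 : 1 <= T%:R :> R by rewrite ler1n.
have z1 : 1 <= z by rewrite -sqrtr1 ler_sqrt // ltW.
have z0 : 0 < z by lra.
have zz : z ^+ 2 = T%:R by rewrite sqr_sqrtr // ltW //; lra.
(* Chosen so that T th^2 / mu^2 = 1/16. *)
pose th := mu / (4 * z).
have th0 : 0 < th by rewrite divr_gt0 // mulr_gt0.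
have th1 : th <= 1 / 2.
  by rewrite ler_pdivrMr ?mulr_gt0 //; lra.
have [x [y [xmu ymu xy gap gap_sum]]] := envs th ltac:(lra).
have C_le : T%:R * ((x - y) ^+ 2 / mu ^+ 2) <= 1 / 16.
  apply: (@le_trans _ _ (T%:R * (th ^+ 2 / mu ^+ 2))).
    apply: ler_wpM2l; first by lra.
    by apply: ler_wpM2r; rewrite // invr_ge0 sqr_ge0.
  by rewrite -zz /th le_eqVlt; apply/orP; left; apply/eqP; field; rewrite !gt_eqF.
pose al := kappa * th; have al0 : 0 < al by rewrite mulr_gt0.
have {}gap_sum i : al <= (mloss i x - mloss a x) + (mloss i y - mloss b y) := gap_sum i.
pose be := al * (T%:R * ((x - y) ^+ 2 / mu ^+ 2)).
have q_ge0 : 0 <= (x - y) ^+ 2 / mu ^+ 2 := divr_ge0 (sqr_ge0 _) (sqr_ge0 _).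
have be_ge0 : 0 <= be by apply: mulr_ge0 (ltW al0) (mulr_ge0 _ q_ge0).
have be_le : be <= al / 16.
  have -> : al / 16 = al * (1 / 16) by field.
  by apply: ler_wpM2l => //; exact: ltW.
have gap1_ge0 i : 0 <= mloss i x - mloss a x.
  by apply: le_trans (gap i).1; rewrite divr_ge0 // subr_ge0.
have gap2_ge0 i : 0 <= mloss i y - mloss b y.
  by apply: le_trans (gap i).2; rewrite divr_ge0 // subr_ge0.
have x01 : 0 <= x <= 1 by lra.
have y01 : 0 <= y <= 1 by lra.
apply: le_trans (minimax_regret_two_environments be_ge0 gap1_ge0 gap2_ge0 gap_sum _ x01 y01).
  rewrite lee_fin; apply: (@le_trans _ _ (z ^+ 2 * (al * 3 / 16))).
    have -> : z ^+ 2 * (al * 3 / 16) = kappa * mu * 3 / 64 * z.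
      by rewrite /al /th; field; rewrite gt_eqF.
    by apply: ler_wpM2r; [exact: ltW|have := mulr_gt0 kappa0 mu0; lra].
  by rewrite zz; apply: ler_wpM2l; lra.
move=> i _; split; [lra..|] => n u v nT u0 v0.
have uv0 : 0 < u + v by rewrite addr_gt0.
have : al * harmonic u v <= (mloss i x - mloss a x + (mloss i y - mloss b y)) * harmonic u v.
  by apply: ler_wpM2r; [exact: harmonic_ge0|exact: gap_sum].
have := harmonic_le u0 v0 (gap1_ge0 i) (gap2_ge0 i).
have := harmonic_split u0 v0 mu0 xmu ymu.
set D := harmonic u v - _ - _ => D_le.
have : n%:R * (al * D) <= be * (u + v).
  apply: (@le_trans _ _ (n%:R * (al * ((x - y) ^+ 2 / mu ^+ 2 * (u + v))))).
    by apply: ler_wpM2l => //; apply: ler_wpM2l => //; exact: ltW.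
  have -> : be * (u + v) = T%:R * (al * ((x - y) ^+ 2 / mu ^+ 2 * (u + v))) by rewrite /be; ring.
  apply: ler_wpM2r; last by rewrite ler_nat ltnW.
  exact: mulr_ge0 (ltW al0) (mulr_ge0 q_ge0 (ltW uv0)).
lra.
Qed.

(** Here [be] is 0: a revealing action pays for its information with its own gap, which is bounded
    away from 0 near x0. *)
Lemma minimax_regret_two_thirds_ge :
  (forall i, revealing i -> mloss a x0 < mloss i x0) ->
  exists2 c : R, 0 < c &
    forall T, (0 < T)%N -> ((c * T%:R `^ (2 / 3))%:E <= minimax_regret G T)%E.
Proof.
move=> rev_gt; have [kappa [mu [kappa0 mu01 envs]]] := tie_environments nda ndb ndup x001 tie min0.
have /andP[mu0 mu1] := mu01.
have [delta [delta0 _ delta_le]] : exists e : R, [/\ 0 < e, e <= 1 &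
    forall i, revealing i -> e <= mloss i x0 - mloss a x0].
  apply: (pos_lower_bound (P := fun i => revealing i)) => i /rev_gt.
  by rewrite subr_gt0.
(* The second bound yields kappa m <= delta / 4. *)
pose m := Num.min mu (delta / (4 * (kappa + 1))).
have m0 : 0 < m by rewrite lt_min mu0 divr_gt0 // mulr_gt0 ?addr_gt0.
have m_mu : m <= mu by rewrite ge_min lexx.
have m_delta : kappa * m <= delta / 4.
  have : m <= delta / (4 * (kappa + 1)) by rewrite ge_min lexx orbT.
  rewrite ler_pdivlMr ?mulr_gt0 ?addr_gt0 //; lra.
exists (kappa * m / 4); first by rewrite divr_gt0 ?mulr_gt0.
move=> T T0; pose z : R := T%:R `^ (1 / 3).
have T1 : 1 <= T%:R :> R by rewrite ler1n.
have z1 : 1 <= z.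
  have : 1 `^ (1 / 3) <= z by apply: ge0_ler_powR; rewrite ?nnegrE; lra.
  by rewrite powR1.
have z0 : 0 < z by lra.
have zzz : z ^+ 3 = T%:R.
  by rewrite -powR_mulrn ?ltW // -powRrM (_ : 1 / 3 * 3%:R = 1) ?powRr1 //; field.
have -> : T%:R `^ (2 / 3) = z ^+ 2.
  by rewrite -powR_mulrn ?ltW // -powRrM; congr (_ `^ _); field.
(* Of order T^(-1/3), so that T kappa th^3 / m^2 = kappa m. *)
pose th := m / z.
have th0 : 0 < th by rewrite divr_gt0.
have th_m : th <= m by rewrite ler_pdivrMr // ler_peMr // ltW.
have [x [y [xmu ymu xy gap gap_sum]]] := envs th ltac:(lra).
pose al := kappa * th; have al0 : 0 < al by rewrite mulr_gt0.
have {}gap_sum i : al <= (mloss i x - mloss a x) + (mloss i y - mloss b y) := gap_sum i.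
have al_le : al <= delta / 4.
  by apply: le_trans m_delta; apply: ler_wpM2l => //; exact: ltW.
have q_ge0 : 0 <= (x - y) ^+ 2 / mu ^+ 2 := divr_ge0 (sqr_ge0 _) (sqr_ge0 _).
have cost_le : T%:R * (al * ((x - y) ^+ 2 / mu ^+ 2)) <= delta / 4.
  apply: le_trans m_delta.
  apply: (@le_trans _ _ (T%:R * (al * (th ^+ 2 / m ^+ 2)))).
    apply: ler_wpM2l; first by lra.
    apply: ler_wpM2l; first exact: ltW.
    apply: ler_pM => //; rewrite ?sqr_ge0 ?invr_ge0 ?sqr_ge0 //.
    by rewrite lef_pV2 ?posrE ?exprn_gt0 // ler_pXn2r // ?nnegrE ltW.
  by rewrite -zzz /al /th le_eqVlt; apply/orP; left; apply/eqP; field; rewrite !gt_eqF.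
have gap1_ge0 i : 0 <= mloss i x - mloss a x.
  by apply: le_trans (gap i).1; rewrite divr_ge0 // subr_ge0.
have gap2_ge0 i : 0 <= mloss i y - mloss b y.
  by apply: le_trans (gap i).2; rewrite divr_ge0 // subr_ge0.
have x01 : 0 <= x <= 1 by lra.
have y01 : 0 <= y <= 1 by lra.
apply: le_trans (minimax_regret_two_environments (lexx 0) gap1_ge0 gap2_ge0 gap_sum _ x01 y01).
  rewrite lee_fin -zzz subr0 le_eqVlt; apply/orP; left; apply/eqP.
  by rewrite /al /th; field; rewrite gt_eqF.
move=> i rev; split; [lra..|] => n u v nT u0 v0; rewrite mul0r addr0.
have uv0 : 0 < u + v by rewrite addr_gt0.
(* Of the gap delta / 2 left in each environment, one half covers the [harmonic] term and the other
   half the information. *)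
have gap_rev w c : 0 < w -> (mloss i x0 - mloss a x0) / 2 <= c -> w * (delta / 2) <= w * c.
  move=> w0 le_c; apply: ler_wpM2l; first exact: ltW.
  by apply: le_trans le_c; have := delta_le i rev; lra.
have := gap_rev u _ u0 (gap i).1; have := gap_rev v _ v0 (gap i).2.
have : al * harmonic u v <= delta / 4 * (u + v).
  by apply: ler_pM => //; [exact: ltW|exact: harmonic_ge0|exact: harmonic_le_sum].
have := harmonic_split u0 v0 mu0 xmu ymu.
set D := harmonic u v - _ - _ => D_le.
have : n%:R * (al * D) <= delta / 4 * (u + v).
  apply: (@le_trans _ _ (n%:R * (al * ((x - y) ^+ 2 / mu ^+ 2 * (u + v))))).
    by apply: ler_wpM2l => //; apply: ler_wpM2l => //; exact: ltW.
  apply: (@le_trans _ _ (T%:R * (al * ((x - y) ^+ 2 / mu ^+ 2)) * (u + v))).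
    rewrite -[T%:R * _ * _]mulrA -[al * _ * _]mulrA; apply: ler_wpM2r; last by rewrite ler_nat ltnW.
    exact: mulr_ge0 (ltW al0) (mulr_ge0 q_ge0 (ltW uv0)).
  by apply: ler_wpM2r => //; exact: ltW.
lra.
Qed.

End Tie.

(** The environments 1 and 0 are the two constant sequences, which feedback cannot tell apart. An
    action optimal in both would be optimal everywhere, which is impossible as a or b is not its
    duplicate. *)
Lemma minimax_regret_linear_ge a b : ~ dominated a -> ~ dominated b ->
  ~~ duplicate a b -> (forall i : action, ~~ revealing i) ->
  exists2 c : R, 0 < c & forall T, ((c * T%:R)%:E <= minimax_regret G T)%E.
Proof.
move=> nda ndb ndup nrev.
case: (arg_minP (fun i => loss G i outcome1) (erefl : xpredT (ord0 : action))) => k1 _ min1.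
case: (arg_minP (fun i => loss G i outcome2) (erefl : xpredT (ord0 : action))) => k2 _ min2.
have g1E i : mloss i 1 = loss G i outcome1 by rewrite /mloss; ring.
have g2E i : mloss i 0 = loss G i outcome2 by rewrite /mloss; ring.
have gap1_ge0 i : 0 <= mloss i 1 - mloss k1 1 by rewrite !g1E subr_ge0 min1.
have gap2_ge0 i : 0 <= mloss i 0 - mloss k2 0 by rewrite !g2E subr_ge0 min2.
have gap_gt0 i : 0 < (mloss i 1 - mloss k1 1) + (mloss i 0 - mloss k2 0).
  rewrite lt_neqAle addr_ge0 // andbT eq_sym; apply/negP => /eqP gap0.
  have [k [ndk ik]] : exists k, ~ dominated k /\ ~~ duplicate i k.
    have [ia|nia] := boolP (duplicate i a); last by exists a.
    by exists b; split=> //; rewrite /duplicate (eqP ia).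
  move: gap0 (gap1_ge0 i) (gap2_ge0 i); rewrite !g1E !g2E => gap0 gap1 gap2.
  have [x [x01 best]] := (nondominatedP k).1 ndk.
  have := best i ik; rewrite ltNge => /negP; apply.
  by rewrite /mloss; apply: lerD; apply: ler_wpM2r;
    [lra|have := min1 k isT; lra|lra|have := min2 k isT; lra].
have [c [c0 _ c_le]] := pos_lower_bound (P := xpredT) (fun i _ => gap_gt0 i).
exists (c / 4); first by rewrite divr_gt0.
move=> T; rewrite (_ : c / 4 * T%:R = T%:R * (c / 4 - 0)); last by ring.
apply: (@minimax_regret_two_environments _ _ G k1 k2 1 0 c 0 T) => //; rewrite ?lexx ?ler01 //.
  by move=> i; exact: c_le.
by move=> i; rewrite (negbTE (nrev i)).
Qed.

End LowerBounds.
(** * Exponential weights *)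

(** Multiply by exp y >= 1 + y: the product (1 - y + 2 y^2)(1 + y) = 1 + y^2 (1 + 2 y) is at least
    1. *)
Lemma expRN_le (R : realType) (y : R) : - (1 / 2) <= y ->
  expR (- y) <= 1 - y + 2 * y ^+ 2.
Proof.
move=> y_ge; have exp_ge := expR_ge1Dx y; rewrite expRN.
have exp_gt0 := expR_gt0 y.
rewrite -div1r ler_pdivrMr //.
have poly_ge0 : 0 <= 1 - y + 2 * y ^+ 2.
  have -> : 1 - y + 2 * y ^+ 2 = 2 * (y - 1 / 4) ^+ 2 + 7 / 8 by field.
  by rewrite addr_ge0 // mulr_ge0 // sqr_ge0.
apply: le_trans (ler_wpM2l poly_ge0 exp_ge).
have -> : (1 - y + 2 * y ^+ 2) * (1 + y) = 1 + y ^+ 2 * (1 + 2 * y) by ring.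
by rewrite lerDl mulr_ge0 ?sqr_ge0 //; lra.
Qed.

Section UpperBound.
Context (R : realType) (Sigma : eqType) (G : game R Sigma 2).
Notation action := 'I_(nact G).+1.
Notation aloss := (@action_loss R Sigma 2 G).
Implicit Types (i k a : action) (p q th : action -> R) (j : 'I_2).

Definition distr p : Prop := (forall i, 0 <= p i) /\ \sum_i p i = 1.

Lemma action_loss_counts (Js : seq 'I_2) : exists n1 n2 : R, [/\ 0 <= n1, 0 <= n2 &
  forall i, aloss i Js = n1 * loss G i outcome1 + n2 * loss G i outcome2].
Proof.
elim: Js => [|j Js [n1 [n2 [n10 n20 IH]]]].
  by exists 0, 0; split=> // i; rewrite /action_loss big_nil !mul0r addr0.
case: (outcome_cases j) => ->; [exists (n1 + 1), n2|exists n1, (n2 + 1)];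
  by split; rewrite ?addr_ge0 // => i; rewrite /action_loss big_cons -/(aloss i Js) IH; ring.
Qed.

Section ExponentialWeights.
(** Weights live on [S]; [gam] is the rate of exploring with [r0] and [eta] the learning rate.
    [base] turns the weights into a law of play, [ref] selects the reference action, and [D]
    compares the mass off the reference with the revealing mass. *)
Variables (S : pred action) (r0 : action) (B gam eta D : R).
Variables (base : (action -> R) -> action -> R) (ref : (action -> R) -> action).
Hypotheses (r0_rev : revealing r0) (B_gt0 : 0 < B)
  (loss_le : forall i k j, `|loss G i j - loss G k j| <= B)
  (gam_gt0 : 0 < gam) (gam_le1 : gam <= 1) (eta_gt0 : 0 < eta) (eta_le : eta * B <= gam / 2).
Let mix p a := (1 - gam) * base p a + gam * (a == r0)%:R.
Let rev_mass p := \sum_(a | revealing a) mix p a.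
Hypothesis base_ok : forall p, distr p -> (forall i, ~~ S i -> p i = 0) ->
  [/\ S (ref p), distr (base p),
    forall j, \sum_a base p a * loss G a j <= \sum_i p i * loss G i j &
    1 - p (ref p) <= D * rev_mass p].
Variable i0 : action.
Hypothesis i0_S : S i0.

Definition total_weight th : R := \sum_(i | S i) expR (th i).

Definition exp_weights th i : R := if S i then expR (th i) / total_weight th else 0.

Definition played th : action -> R := mix (exp_weights th).

(** Importance weighting: the estimate is used in revealing rounds only, so its mean is the loss of
    i relative to the reference. *)
Definition estimate th j i : R :=
  (loss G i j - loss G (ref (exp_weights th)) j) / rev_mass (exp_weights th).

Definition reweight th j i : R := th i - eta * estimate th j i.

Definition update th a (sigma : Sigma) : action -> R :=
  if revealing a then
    reweight th (if sigma == feedback G a outcome1 then outcome1 else outcome2)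
  else th.

Lemma total_weight_gt0 th : 0 < total_weight th.
Proof.
rewrite /total_weight (bigD1 i0) //= ltr_pwDl ?expR_gt0 //.
by apply: sumr_ge0 => i _; exact: expR_ge0.
Qed.

Lemma exp_weights_distr th : distr (exp_weights th).
Proof.
have W0 := total_weight_gt0 th; split=> [i|].
  by rewrite /exp_weights; case: ifP => // _; rewrite divr_ge0 ?expR_ge0 // ltW.
rewrite /exp_weights -big_mkcond -mulr_suml -/(total_weight th).
by rewrite divff // gt_eqF.
Qed.

Lemma exp_weights_supp th i : ~~ S i -> exp_weights th i = 0.
Proof. by rewrite /exp_weights => /negbTE ->. Qed.

Let ok th := base_ok (exp_weights_distr th) (@exp_weights_supp th).

Lemma played_distr th : distr (played th).
Proof.
have [g0 g1 e_le] := And3 gam_gt0 gam_le1 eta_le.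
have [_ [b_ge0 b_sum] _ _] := ok th; split=> [a|].
  by apply: addr_ge0; apply: mulr_ge0 => //; lra.
rewrite big_split /= -!mulr_sumr b_sum (bigD1 r0) //= eqxx big1 ?addr0 => [|a /negbTE->//].
by rewrite !mulr1; ring.
Qed.

Lemma rev_mass_ge th : gam <= rev_mass (exp_weights th).
Proof.
have [g0 g1 e_le] := And3 gam_gt0 gam_le1 eta_le.
have [_ [b_ge0 b_sum] _ _] := ok th.
rewrite /rev_mass (bigD1 r0) //= {1}/mix eqxx mulr1.
have : 0 <= (1 - gam) * base (exp_weights th) r0 by apply: mulr_ge0 => //; lra.
have : 0 <= \sum_(a | revealing a && (a != r0)) mix (exp_weights th) a.
  by apply: sumr_ge0 => a _; exact: (played_distr th).1.
lra.
Qed.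

Lemma update_feedback th a j :
  update th a (feedback G a j) = if revealing a then reweight th j else th.
Proof.
rewrite /update; case: ifP => // /negP rev; congr reweight.
case: (outcome_cases j) => ->; first by rewrite eqxx.
by case: eqP => // eq_fb; case: rev; rewrite /revealing eq_fb eqxx.
Qed.

(** The ratio of the total weights is the mean of exp(- eta estimate), to which [expRN_le] and ln(1
    + x) <= x apply. The condition of [expRN_le] follows from eta B <= gam / 2 and a revealing mass
    of at least gam. *)
Lemma total_weight_reweight th j :
  ln (total_weight (reweight th j)) - ln (total_weight th) <=
  \sum_i exp_weights th i * (2 * (eta * estimate th j i) ^+ 2 - eta * estimate th j i).
Proof.
have [g0 g1 e_le] := And3 gam_gt0 gam_le1 eta_le.
have W0 := total_weight_gt0 th; have W1 := total_weight_gt0 (reweight th j).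
have Q_ge := rev_mass_ge th; have Q0 : 0 < rev_mass (exp_weights th) by lra.
rewrite -ln_div ?posrE //.
have ratioE : total_weight (reweight th j) / total_weight th =
    \sum_i exp_weights th i * expR (- (eta * estimate th j i)).
  rewrite {1}/total_weight big_mkcond mulr_suml; apply: eq_bigr => i _.
  rewrite /exp_weights; case: ifP => _; last by rewrite !mul0r.
  by rewrite /reweight expRD mulrAC.
have ratio_le : total_weight (reweight th j) / total_weight th <=
    1 + \sum_i exp_weights th i * (2 * (eta * estimate th j i) ^+ 2 - eta * estimate th j i).
  rewrite ratioE -[X in _ <= X + _](exp_weights_distr th).2 -big_split; apply: ler_sum => i _ /=.
  rewrite -{2}[exp_weights th i]mulr1 -mulrDr ler_wpM2l ?(exp_weights_distr th).1 //.
  apply: le_trans (expRN_le _) _; last by lra.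
  rewrite /estimate mulrA ler_pdivlMr //.
  have : `|eta * (loss G i j - loss G (ref (exp_weights th)) j)| <= eta * B.
    by rewrite normrM gtr0_norm // ler_pM2l.
  rewrite ler_norml => /andP[? _]; lra.
have ratio0 : 0 < total_weight (reweight th j) / total_weight th by rewrite divr_gt0.
have -> : total_weight (reweight th j) / total_weight th =
  1 + (total_weight (reweight th j) / total_weight th - 1) by ring.
apply: (@le_trans _ _ (total_weight (reweight th j) / total_weight th - 1)).
  by apply: le_ln1Dx; lra.
by lra.
Qed.

(** The potential (ln W - th i) / eta, with W the total weight, bounds the regret to come. Its
    expected drift in a round cancels the regret of that round up to a constant. *)
Lemma value_exp_weights i (Js : seq 'I_2) th : S i ->
  value played update th Js <= aloss i Js +
    (ln (total_weight th) - th i) / eta +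
    (size Js)%:R * (gam * B + 2 * eta * B ^+ 2 * D).
Proof.
have [g0 g1 e_le] := And3 gam_gt0 gam_le1 eta_le.
move=> iS; elim: Js th => [|j Js IH] th.
  rewrite /= mul0r addr0 /action_loss big_nil add0r divr_ge0 ?(ltW eta_gt0) // subr_ge0.
  rewrite -[th i]expRK ler_ln ?posrE ?expR_gt0 ?total_weight_gt0 //.
  rewrite /total_weight (bigD1 i) //= lerDl; apply: sumr_ge0 => ? _; exact: expR_ge0.
set C := gam * B + 2 * eta * B ^+ 2 * D.
pose U th := aloss i Js + (ln (total_weight th) - th i) / eta + (size Js)%:R * C.
set p := exp_weights th; set Q := rev_mass p; set m := ref p.
have [mS [b_ge0 b_sum] b_loss ref_le] := ok th.
have {}ref_le : 1 - p m <= D * Q by [].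
have [q_ge0 q_sum] := played_distr th; have [p_ge0 p_sum] := exp_weights_distr th.
have Q_ge : gam <= Q := rev_mass_ge th; have Q0 : 0 < Q by lra.
(* The exponents change with probability Q, and otherwise stay as they are. *)
have step : value played update th (j :: Js) <=
    \sum_a played th a * loss G a j + (Q * U (reweight th j) + (1 - Q) * U th).
  rewrite /=; under eq_bigr do rewrite mulrDr.
  rewrite big_split lerD2l /= (bigID (@revealing _ _ G)) /=.
  have nrevE : 1 - Q = \sum_(a | ~~ revealing a) played th a.
    have : Q + \sum_(a | ~~ revealing a) played th a = 1.
      by rewrite -[RHS]q_sum [RHS](bigID (@revealing _ _ G)).
    lra.
  rewrite nrevE /Q /rev_mass !mulr_suml; apply: lerD; apply: ler_sum => a rev.
    by rewrite ler_wpM2l // update_feedback rev IH.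
  by rewrite ler_wpM2l // update_feedback (negbTE rev) IH.
have pot_le : Q * (U (reweight th j) - U th) <=
    loss G i j - \sum_k p k * loss G k j + 2 * eta * B ^+ 2 * D.
  have -> : U (reweight th j) - U th =
      (ln (total_weight (reweight th j)) - ln (total_weight th)) / eta + estimate th j i.
    by rewrite /U /reweight; field; rewrite gt_eqF.
  have est_le : (ln (total_weight (reweight th j)) - ln (total_weight th)) / eta <=
      \sum_k p k * (2 * eta * estimate th j k ^+ 2 - estimate th j k).
    rewrite ler_pdivrMr // (le_trans (total_weight_reweight th j)) // mulr_suml.
    by apply: ler_sum => k _; rewrite -/p le_eqVlt; apply/orP; left; apply/eqP; ring.
  apply: (@le_trans _ _ (Q * (\sum_k p k * (2 * eta * estimate th j k ^+ 2 - estimate th j k)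
      + estimate th j i))); first by rewrite ler_pM2l // lerD2r.
  (* The reference m contributes nothing, so only the mass 1 - p m <= D Q counts. This absorbs the
     factor 1 / Q of the second-order term. *)
  have sq_le : \sum_k p k * (loss G k j - loss G m j) ^+ 2 <= B ^+ 2 * (D * Q).
    apply: (@le_trans _ _ (\sum_(k | k != m) p k * B ^+ 2)).
      rewrite (bigD1 m) //= subrr expr0n mulr0 add0r; apply: ler_sum => k _.
      rewrite ler_wpM2l // -[(_ - _) ^+ 2]real_normK ?num_real //.
      by rewrite ler_pXn2r ?nnegrE ?(ltW B_gt0).
    rewrite -mulr_suml mulrC ler_wpM2l ?sqr_ge0 // (le_trans _ ref_le) //.
    have : p m + \sum_(k | k != m) p k = 1 by rewrite -[RHS]p_sum [RHS](bigD1 m).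
    lra.
  have -> : Q * (\sum_k p k * (2 * eta * estimate th j k ^+ 2 - estimate th j k) + estimate th j i)
    = 2 * eta * (\sum_k p k * (loss G k j - loss G m j) ^+ 2) / Q
      - \sum_k p k * (loss G k j - loss G m j) + (loss G i j - loss G m j).
    have estE k : Q * estimate th j k = loss G k j - loss G m j.
      by rewrite mulrC divfK // gt_eqF.
    rewrite mulrDr estE; congr (_ + _).
    rewrite !mulr_sumr mulr_suml -sumrB; apply: eq_bigr => k _.
    by rewrite -estE; field; rewrite gt_eqF.
  have -> : \sum_k p k * (loss G k j - loss G m j) = \sum_k p k * loss G k j - loss G m j.
    by under eq_bigr do rewrite mulrBr; rewrite sumrB -mulr_suml p_sum mul1r.
  have : 2 * eta * (\sum_k p k * (loss G k j - loss G m j) ^+ 2) / Q <= 2 * eta * B ^+ 2 * D.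
    rewrite ler_pdivrMr // -!mulrA; do 2 (rewrite ler_pM2l; last by []).
    by rewrite mulrA.
  lra.
(* [base] is no worse than the weights, and exploration costs at most gam B. *)
have play_le : \sum_a played th a * loss G a j <= \sum_k p k * loss G k j + gam * B.
  have -> : \sum_a played th a * loss G a j =
      (1 - gam) * (\sum_a base p a * loss G a j) + gam * loss G r0 j.
    rewrite /played /mix -/p; under eq_bigr do rewrite mulrDl -!mulrA.
    rewrite big_split /= -!mulr_sumr; congr (_ + _ * _).
    rewrite (bigD1 r0) //= eqxx mul1r big1 ?addr0 // => a /negbTE ->.
    by rewrite mul0r.
  have base_le : (1 - gam) * (\sum_a base p a * loss G a j) <=
      (1 - gam) * (\sum_k p k * loss G k j).
    by apply: ler_wpM2l; [lra|exact: b_loss].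
  have : loss G r0 j - \sum_k p k * loss G k j <= B.
    rewrite -[loss G r0 j]mul1r -[B]mul1r -p_sum !mulr_suml -sumrB; apply: ler_sum => k _.
    by rewrite -mulrBr ler_wpM2l // (le_trans (ler_norm _)).
  rewrite -subr_ge0 => /(mulr_ge0 (ltW gam_gt0)); lra.
apply: le_trans step _.
have -> : aloss i (j :: Js) + (ln (total_weight th) - th i) / eta + (size (j :: Js))%:R * C =
    loss G i j + U th + C.
  by rewrite /U /action_loss big_cons [size _]/= -natr1; ring.
have CE : C = gam * B + 2 * eta * B ^+ 2 * D by [].
move: pot_le play_le CE; move: (U _) (U _) => U1 U2; lra.
Qed.

Hypothesis S_cover : forall n1 n2 i, 0 <= n1 -> 0 <= n2 -> exists k, S k /\
  n1 * loss G k outcome1 + n2 * loss G k outcome2 <=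
  n1 * loss G i outcome1 + n2 * loss G i outcome2.

(** Start from zero exponents, where the total weight is at most the number of actions. By [S_cover]
    a competitor can be replaced by one in [S]. *)
Lemma minimax_regret_exp_weights T : (minimax_regret G T <=
  (ln (nact G).+1%:R / eta + T%:R * (gam * B + 2 * eta * B ^+ 2 * D))%:E)%E.
Proof.
have q_ge0 th a : 0 <= played th a := (played_distr th).1 a.
have q_sum1 th : \sum_a played th a = 1 := (played_distr th).2.
apply: (minimax_regret_le_value (upd := update) q_ge0 q_sum1 (x := fun=> 0)).
move=> Js i sz; have [n1 [n2 [n10 n20 lossE]]] := action_loss_counts Js.
have [k [kS le_k]] := S_cover i n10 n20.
have le_ki : aloss k Js <= aloss i Js by rewrite !lossE.
rewrite lerBlDr (le_trans (value_exp_weights Js _ kS)) // sz subr0.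
have : ln (total_weight (fun=> 0)) / eta <= ln (nact G).+1%:R / eta.
  rewrite ler_wpM2r ?invr_ge0 ?(ltW eta_gt0) // ler_ln ?posrE ?total_weight_gt0 ?ltr0Sn //.
  rewrite /total_weight big_mkcond -[X in _ <= X%:R](card_ord (nact G).+1) -sum1_card natr_sum.
  by apply: ler_sum => a _; case: ifP => _; rewrite ?expR0 ?ler01.
by lra.
Qed.

End ExponentialWeights.
End UpperBound.

(** * The rates of the upper bounds *)

Lemma sum_delta (R : pzRingType) (I : finType) (x : I) (F : I -> R) :
  \sum_a (a == x)%:R * F a = F x.
Proof.
rewrite (bigD1 x) //= eqxx mul1r big1 ?addr0 // => a /negbTE ->.
by rewrite mul0r.
Qed.

Section UpperBounds.
Context (R : realType) (Sigma : eqType) (G : game R Sigma 2).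
Notation action := 'I_(nact G).+1.
Implicit Types (i k a s m r : action) (p q : action -> R).

Lemma loss_diff_le i k j : `|loss G i j - loss G k j| <= 2 * loss_bound G + 1.
Proof.
have := le_loss_bound i j; have := le_loss_bound k j.
have := ler_normB (loss G i j) (loss G k j); lra.
Qed.

Lemma loss_bound_ge0 : 0 <= loss_bound G.
Proof. exact: sumr_ge0. Qed.

Lemma minimax_regret_le_pure (I : seq Sigma -> action) T (c : R) :
  (forall Js, size Js = T -> regret I Js <= c) -> (minimax_regret G T <= c%:E)%E.
Proof.
move=> Hc; have sum1 : \sum_(w : unit) 1 = 1 :> R by rewrite sumr_const card_unit.
have [A AE] := mixed_strategy (fun _ : unit => I) (fun=> ler01) sum1.
apply: ge_ereal_inf; exists (worst_regret T A); first by exists A.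
apply/ereal_supP => _ [J _ <-]; rewrite AE lee_fin sumr_const card_unit mul1r.
exact/Hc/size_tuple.
Qed.

Lemma minimax_regret_le_linear T :
  (minimax_regret G T <= (T%:R * (2 * loss_bound G))%:E)%E.
Proof.
apply: (minimax_regret_le_pure (I := fun=> ord0)) => Js <-.
exact: le_trans (ler_norm _) (regret_bound _ _).
Qed.

Lemma loss_from_cst i (s : seq Sigma) Js :
  loss_from (fun=> i) s Js = action_loss i Js.
Proof.
elim: Js s => [|j Js IH] s; first by rewrite /loss_from /action_loss !big_nil.
by rewrite loss_from_cons IH /action_loss big_cons.
Qed.

Section Transfer.
Variables (S : pred action) (i0 : action) (i0_S : S i0).
Hypothesis transfer : forall s m, S s -> S m -> s != m ->
  ~~ revealing s -> ~~ revealing m -> exists r (al : R),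
  [/\ revealing r, 0 <= al <= 1 &
    forall j, loss G r j <= al * loss G s j + (1 - al) * loss G m j].

(* Mass on two non-revealing actions is partly moved to a revealing action whose
   loss lies below their chord; only the heaviest non-revealing action keeps mass
   that the revealing mass does not control. *)
Lemma revealing_transfer p : distr p -> (forall i, ~~ S i -> p i = 0) ->
  exists m q, [/\ S m, distr q,
    forall j, \sum_a q a * loss G a j <= \sum_i p i * loss G i j &
    1 - p m <= (nact G).+1%:R * \sum_(a | revealing a) q a].
Proof.
move=> [p_ge0 p_sum] p_supp; set N : R := (nact G).+1%:R.
have N_ge1 : 1 <= N by rewrite ler1n.
have N_gt0 : 0 < N by lra.
have [/existsP[m0 /andP[m0S m0rev]]|none] := boolP [exists m, S m && ~~ revealing m]; last first.
  exists i0, p; split=> //.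
  have -> : \sum_(a | revealing a) p a = 1.
    rewrite -p_sum [RHS](bigID (@revealing _ _ G)) /= [X in _ + X]big1 ?addr0 // => a nrev.
    apply: p_supp; move: none; rewrite negb_exists => /forallP/(_ a).
    by rewrite nrev andbT.
  by have := p_ge0 i0; lra.
case: (arg_maxP (P := fun m => S m && ~~ revealing m) p (introT andP (conj m0S m0rev))).
move=> m /andP[mS mrev] m_max.
have {}m_max s : S s -> ~~ revealing s -> p s <= p m.
  by move=> sS srev; apply: m_max; rewrite sS.
pose U s := [&& S s, ~~ revealing s & s != m].
have /choice[f f_ok] : forall s, exists ral : action * R, U s ->
    [/\ revealing ral.1, 0 <= ral.2 <= 1 &
    forall j, loss G ral.1 j <= ral.2 * loss G s j + (1 - ral.2) * loss G m j].
  move=> s; have [/and3P[sS srev sm]|_] := boolP (U s); last by exists (s, 0).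
  by have [r [al ok]] := transfer sS mS sm srev mrev; exists (r, al).
(* For each s, mass p s / N moves to the revealing action [(f s).1], taken from s and m in the
   proportions of the chord. *)
pose q a := p a + \sum_(s | U s) p s / N *
  ((a == (f s).1)%:R - (f s).2 * (a == s)%:R - (1 - (f s).2) * (a == m)%:R).
have q_sum (F : action -> R) : \sum_a q a * F a = \sum_a p a * F a +
    \sum_(s | U s) p s / N * (F (f s).1 - (f s).2 * F s - (1 - (f s).2) * F m).
  rewrite /q; under eq_bigr do rewrite mulrDl; rewrite big_split /=; congr (_ + _).
  under eq_bigr do rewrite mulr_suml; rewrite exchange_big /=; apply: eq_bigr => s _.
  rewrite -(sum_delta (f s).1 F) -(sum_delta s F) -(sum_delta m F) 2!mulr_sumr -!sumrB mulr_sumr.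
  by apply: eq_bigr => a _; ring.
have pN_ge0 s : 0 <= p s / N by rewrite divr_ge0 // ltW.
exists m, q; split=> //.
- split=> [a|]; last first.
    under eq_bigr do rewrite -[q _]mulr1; rewrite q_sum.
    under eq_bigr do rewrite mulr1; rewrite p_sum big1 ?addr0 // => s _.
    by rewrite !mulr1; ring.
  (* One transfer takes at most p a / N from a, for a = m because p s <= p m. There are at most N
     transfers, so q stays nonnegative. *)
  have term_ge s : U s -> - (p a / N) <= p s / N *
      ((a == (f s).1)%:R - (f s).2 * (a == s)%:R - (1 - (f s).2) * (a == m)%:R).
    move=> Us; have [_ /andP[al0 al1] _] := f_ok s Us; have /and3P[sS srev sm] := Us.
    have d_ge0 : 0 <= (a == (f s).1)%:R :> R by [].
    have [am|nam] := eqVneq a m.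
      have -> : (a == s) = false by rewrite am eq_sym (negbTE sm).
      rewrite !mulr0 subr0 mulr1.
      have : p s / N <= p a / N by rewrite ler_wpM2r ?invr_ge0 ?(ltW N_gt0) // am m_max.
      have : 0 <= p s / N * ((a == (f s).1)%:R + (f s).2) by rewrite mulr_ge0 // addr_ge0.
      move: (p s / N) (p a / N) => ps pa; lra.
    have [as_|nas] := eqVneq a s.
      rewrite -as_ in d_ge0 al1 *; rewrite mulr0 subr0 mulr1.
      have : 0 <= p a / N * ((a == (f a).1)%:R + (1 - (f a).2)).
        by rewrite mulr_ge0 // addr_ge0 // subr_ge0.
      move: (p a / N) => pa; lra.
    rewrite !mulr0 !subr0; have := pN_ge0 a; have := mulr_ge0 (pN_ge0 s) d_ge0.
    by move: (p s / N) (p a / N) => ps pa; lra.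
  have : \sum_(s | U s) - (p a / N) <= \sum_(s | U s) p s / N *
      ((a == (f s).1)%:R - (f s).2 * (a == s)%:R - (1 - (f s).2) * (a == m)%:R).
    exact: ler_sum.
  have : - p a <= \sum_(s | U s) - (p a / N).
    have -> : - p a = \sum_(s : action) - (p a / N).
      by rewrite sumr_const card_ord -mulr_natr -/N mulNr divfK // gt_eqF.
    rewrite [X in X <= _](bigID U) /= gerDl; apply: sumr_le0 => s _.
    by rewrite oppr_le0.
  rewrite /q; lra.
- move=> j; rewrite q_sum gerDl; apply: sumr_le0 => s Us.
  have [_ _ /(_ j) le_j] := f_ok s Us.
  by rewrite mulr_ge0_le0 //; lra.
have revE : \sum_(a | revealing a) q a = \sum_(a | revealing a) p a + \sum_(s | U s) p s / N.
  transitivity (\sum_a q a * (revealing a)%:R).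
    by rewrite big_mkcond; apply: eq_bigr => a _; case: ifP => _; rewrite ?mulr1 ?mulr0.
  rewrite q_sum; congr (_ + _).
    by rewrite [RHS]big_mkcond; apply: eq_bigr => a _; case: ifP => _; rewrite ?mulr1 ?mulr0.
  apply: eq_bigr => s Us; have [-> _ _] := f_ok s Us; have /and3P[_ /negbTE-> _] := Us.
  by rewrite (negbTE mrev) !mulr0 !subr0 mulr1.
have p_split : 1 = \sum_(a | revealing a) p a + p m + \sum_(s | U s) p s.
  rewrite -p_sum [LHS](bigID (@revealing _ _ G)) /= -addrA; congr (_ + _).
  rewrite (bigD1 m) //=; congr (_ + _).
  rewrite [LHS]big_mkcond [RHS]big_mkcond; apply: eq_bigr => a _; rewrite /U.
  by have [aS|naS] := boolP (S a); rewrite //= (p_supp _ naS); case: ifP.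
rewrite revE mulrDr mulr_sumr.
under [X in _ <= _ + X]eq_bigr do rewrite mulrC divfK ?gt_eqF //.
have rev_ge0 : 0 <= \sum_(a | revealing a) p a by apply: sumr_ge0.
have : 0 <= (N - 1) * \sum_(a | revealing a) p a by rewrite mulr_ge0 // subr_ge0.
lra.
Qed.

Hypothesis S_cover : forall (n1 n2 : R) i, 0 <= n1 -> 0 <= n2 -> exists k, S k /\
  n1 * loss G k outcome1 + n2 * loss G k outcome2 <=
  n1 * loss G i outcome1 + n2 * loss G i outcome2.

Lemma minimax_regret_sqrt_le r0 : revealing r0 -> exists2 C : R, 0 < C &
  forall T, (0 < T)%N -> (minimax_regret G T <= (C * Num.sqrt T%:R)%:E)%E.
Proof.
move=> r0_rev; set N : R := (nact G).+1%:R.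
have N_ge1 : 1 <= N by rewrite ler1n.
pose B := 2 * loss_bound G + 1.
have B_ge1 : 1 <= B by rewrite lerDr mulr_ge0 // loss_bound_ge0.
have B_gt0 : 0 < B by lra.
have lnN_ge0 : 0 <= ln N by rewrite ln_ge0.
have BB_ge0 : 0 <= B ^+ 2 := sqr_ge0 B.
have NBB_ge0 : 0 <= N * B ^+ 2 by rewrite mulr_ge0 //; lra.
exists (ln N + 4 * B ^+ 2 + 4 * (N * B ^+ 2)).
  have : 1 <= B ^+ 2 by rewrite exprn_ege1.
  lra.
move=> T T_gt0; set z : R := Num.sqrt T%:R.
have z_ge1 : 1 <= z by rewrite -sqrtr1 ler_sqrt ?ltr0n // ler1n.
have z_gt0 : 0 < z by lra.
have zz : T%:R = z ^+ 2 by rewrite sqr_sqrtr.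
(* For small T the linear bound suffices; otherwise gam <= 1/2 below. *)
have [z_small|z_large] := ltrP z (4 * B).
  apply: le_trans (minimax_regret_le_linear T) _; rewrite lee_fin zz.
  apply: (@le_trans _ _ (z * (4 * B * B))).
    rewrite expr2 -mulrA ler_pM2l //.
    by apply: ler_pM; rewrite ?mulr_ge0 ?loss_bound_ge0 ?ltW // /B; lra.
  rewrite [leRHS]mulrC ler_pM2l //.
  have -> : 4 * B * B = 4 * B ^+ 2 by ring.
  lra.
pose gam := 2 * B / z; pose eta := z^-1.
have gam_gt0 : 0 < gam by rewrite divr_gt0 // mulr_gt0.
have gam_le : gam <= 1 / 2 by rewrite ler_pdivrMr //; lra.
have gam_le1 : gam <= 1 by lra.
have eta_gt0 : 0 < eta by rewrite invr_gt0.
have eta_le : eta * B <= gam / 2.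
  by rewrite le_eqVlt; apply/orP; left; apply/eqP; rewrite /gam /eta; field; rewrite gt_eqF.
(* Outside the distributions on [S] the value is a default. *)
have /choice[f f_ok] : forall p, exists mq : action * (action -> R),
    distr p -> (forall i, ~~ S i -> p i = 0) -> [/\ S mq.1, distr mq.2,
    forall j, \sum_a mq.2 a * loss G a j <= \sum_i p i * loss G i j &
    1 - p mq.1 <= N * \sum_(a | revealing a) mq.2 a].
  move=> p; have [[pd ps]|not_ok] := pselect (distr p /\ (forall i, ~~ S i -> p i = 0)).
    by have [m [q ok]] := revealing_transfer pd ps; exists (m, q).
  by exists (i0, p) => pd ps; case: not_ok.
(* D = 2 N: as gam <= 1/2, exploration keeps at least half of the revealing mass of the base law. *)
have le_exp := minimax_regret_exp_weights (base := fun p => (f p).2) (ref := fun p => (f p).1)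
  (D := 2 * N) r0_rev B_gt0 loss_diff_le gam_gt0 gam_le1 eta_gt0 eta_le _ i0_S S_cover T.
apply: le_trans (le_exp _) _.
  move=> p pd ps; have [mS [q_ge0 q_sum] q_loss m_le] := f_ok p pd ps; split=> //.
  apply: le_trans m_le _; rewrite -mulrA mulrCA ler_pM2l; last by lra.
  rewrite big_split /= -mulr_sumr.
  have rev_ge0 : 0 <= \sum_(a | revealing a) (f p).2 a by apply: sumr_ge0.
  have : 0 <= \sum_(a | revealing a) gam * (a == r0)%:R.
    by apply: sumr_ge0 => a _; rewrite mulr_ge0 // ltW.
  have : 1 / 2 * \sum_(a | revealing a) (f p).2 a <=
      (1 - gam) * \sum_(a | revealing a) (f p).2 a by apply: ler_wpM2r => //; lra.
  lra.
rewrite lee_fin zz -/N.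
have -> : ln N / eta + z ^+ 2 * (gam * B + 2 * eta * B ^+ 2 * (2 * N)) =
    (ln N + 2 * B ^+ 2 + 4 * (N * B ^+ 2)) * z.
  by rewrite /gam /eta; field; rewrite gt_eqF.
rewrite ler_pM2r //; lra.
Qed.

End Transfer.

Lemma minimax_regret_two_thirds_le r0 : revealing r0 -> exists2 C : R, 0 < C &
  exists T0, forall T, (T0 <= T)%N ->
    (minimax_regret G T <= (C * T%:R `^ (2 / 3))%:E)%E.
Proof.
move=> r0_rev; set N : R := (nact G).+1%:R.
have N_ge1 : 1 <= N by rewrite ler1n.
pose B := 2 * loss_bound G + 1.
have B_ge1 : 1 <= B by rewrite lerDr mulr_ge0 // loss_bound_ge0.
have B_gt0 : 0 < B by lra.
have lnN_ge0 : 0 <= ln N by rewrite ln_ge0.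
have BB_ge0 : 0 <= B ^+ 2 := sqr_ge0 B.
exists (ln N + B + 2 * B ^+ 2); first by lra.
(* From here on T^(1/3) >= 2 B, which is eta B <= gam / 2. *)
exists (Num.bound ((2 * B) ^+ 3)) => T T_ge.
have T_large : (2 * B) ^+ 3 <= T%:R.
  have : 0 <= (2 * B) ^+ 3 by rewrite exprn_ge0 //; lra.
  move=> /archi_boundP/ltW le_b; apply: le_trans le_b _.
  by rewrite ler_nat.
pose z : R := T%:R `^ (1 / 3).
have z_large : 2 * B <= z.
  have -> : 2 * B = ((2 * B) ^+ 3) `^ (1 / 3).
    rewrite -powR_mulrn -?powRrM; last by lra.
    by rewrite (_ : 3%:R * (1 / 3) = 1) ?powRr1 //; [lra|field].
  by apply: ge0_ler_powR => //; rewrite ?nnegrE ?exprn_ge0 //; lra.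
have z_gt0 : 0 < z by lra.
have zzz : T%:R = z ^+ 3.
  by rewrite -powR_mulrn ?ltW // -powRrM (_ : 1 / 3 * 3%:R = 1) ?powRr1 //; field.
have -> : T%:R `^ (2 / 3) = z ^+ 2.
  by rewrite -powR_mulrn ?ltW // -powRrM; congr (_ `^ _); field.
pose gam := z^-1; pose eta := (z ^+ 2)^-1.
have gam_gt0 : 0 < gam by rewrite invr_gt0.
have gam_le1 : gam <= 1 by rewrite invf_le1 //; lra.
have eta_gt0 : 0 < eta by rewrite invr_gt0 exprn_gt0.
have eta_le : eta * B <= gam / 2.
  have -> : gam / 2 = eta * (z / 2) by rewrite /gam /eta; field; rewrite gt_eqF.
  by rewrite ler_pM2l //; lra.
pose S i := `[< ~ dominated i >].
have S_cover (n1 n2 : R) i : 0 <= n1 -> 0 <= n2 -> exists k, S k /\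
    n1 * loss G k outcome1 + n2 * loss G k outcome2 <=
    n1 * loss G i outcome1 + n2 * loss G i outcome2.
  move=> n1_ge0 n2_ge0.
  have [k [ndk le_k]] := nondominated_count_minimizer i n1_ge0 n2_ge0.
  by exists k; split=> //; exact/asboolP.
have [i0 [i0_S _]] := S_cover 0 0 ord0 (lexx 0) (lexx 0).
(* The revealing mass is at least gam = 1 / z by exploration alone, so D = z works with any
   reference. *)
have le_exp := minimax_regret_exp_weights (base := id) (ref := fun=> i0)
  (D := z) r0_rev B_gt0 loss_diff_le gam_gt0 gam_le1 eta_gt0 eta_le _ i0_S S_cover T.
apply: le_trans (le_exp _) _.
  move=> p [p_ge0 p_sum] ps; split=> //.
  have : gam <= \sum_(a | revealing a) ((1 - gam) * p a + gam * (a == r0)%:R).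
    rewrite (bigD1 r0) //= eqxx mulr1 -addrA addrCA lerDl addr_ge0 //.
      by rewrite mulr_ge0 // subr_ge0.
    apply: sumr_ge0 => a _.
    by rewrite addr_ge0 // mulr_ge0 // ?subr_ge0 // ltW.
  rewrite -(ler_pM2l z_gt0) divff ?gt_eqF // => le1.
  have := p_ge0 i0; lra.
rewrite lee_fin zzz -/N le_eqVlt; apply/orP; left; apply/eqP.
by rewrite /gam /eta; field; rewrite gt_eqF.
Qed.

End UpperBounds.

(** * The separation condition and the classification *)

Section Separated.
Context (R : realType) (Sigma : eqType) (G : game R Sigma 2).
Notation action := 'I_(nact G).+1.

(** Playing the only non-dominated loss vector throughout is best in hindsight for every outcome
    sequence. *)
Lemma minimax_regret_trivial T : num_nondominated G = 1%N ->
  minimax_regret G T = 0%E.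
Proof.
move=> K1; apply/eqP; rewrite eq_le minimax_regret_ge0 andbT.
have x01 : 0 <= (0 : R) <= 1 by rewrite lexx ler01.
have [k [ndk _]] := nondominated_minimizer G x01.
apply: (minimax_regret_le_pure (I := fun=> k)) => Js _.
have [i bE] := best_loss_attained G Js.
rewrite subr_le0 bE [leLHS]loss_from_cst.
have [n1 [n2 [n10 n20 lossE]]] := action_loss_counts G Js.
have [m [ndm le_m]] := nondominated_count_minimizer i n10 n20.
have /duplicateP[eq1 eq2] := num_nondominated1 K1 ndk ndm.
by rewrite !lossE eq1 eq2.
Qed.

Section Removed.
Variables (G' : game R Sigma 2) (f : 'I_(nact G').+1 -> action).
Hypotheses (lossE : loss G' = rowsub f (loss G))
  (feedbackE : feedback G' = rowsub f (feedback G))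
  (f_inj : forall k k', duplicate (f k) (f k') -> k = k')
  (f_onto : forall i, exists k, duplicate (f k) i)
  (f_revealing : forall k i, duplicate (f k) i -> revealing i -> revealing (f k)).
Notation link n := (f (nth ord0 (chain G') n)).

Lemma chain_ndup n : (n.+1 < size (chain G'))%N -> ~~ duplicate (link n) (link n.+1).
Proof.
move=> lt; apply/duplicateP => -[eq1 _].
by have := chain_lt lossE f_inj f_onto (ltnSn n) lt; rewrite eq1 ltxx.
Qed.

Lemma chain_length : (2 <= num_nondominated G)%N -> (1 < size (chain G'))%N.
Proof.
move=> /num_nondominated_ge2[i [k [ndi ndk ndup]]].
exact: (chain_size_ge2 lossE f_onto ndi ndk ndup).
Qed.

Lemma separated_sqrt_ge : (2 <= num_nondominated G)%N -> exists2 c : R, 0 < c &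
  forall T, (0 < T)%N -> ((c * Num.sqrt T%:R)%:E <= minimax_regret G T)%E.
Proof.
move=> /chain_length len.
have [x [x01 tie min0 _]] := chain_tie lossE f_inj f_onto len.
by apply: (minimax_regret_sqrt_ge _ _ (chain_ndup len) x01 tie min0);
  apply: chain_nondominated => //; exact: ltnW.
Qed.

(** The weights run on the kept representatives of the chain, where separation gives the chords
    needed for the transfer. *)
Lemma separated_sqrt_le : (2 <= num_nondominated G)%N ->
    sorted (fun i i' => revealing i || revealing i') (chain G') ->
  exists2 C : R, 0 < C &
    forall T, (0 < T)%N -> (minimax_regret G T <= (C * Num.sqrt T%:R)%:E)%E.
Proof.
move=> /chain_length len sep.
pose S i := `[< exists2 n, (n < size (chain G'))%N & i = link n >].
have S0 : S (link 0) by apply/asboolP; exists 0%N => //; exact: ltnW.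
have [r0 r0_rev] : exists r0 : action, revealing r0.
  have := sortedP ord0 sep 0%N len; rewrite !(revealing_removed feedbackE).
  by case/orP => rev; [exists (link 0)|exists (link 1)].
apply: (minimax_regret_sqrt_le S0 _ _ r0_rev).
- move=> _ _ /asboolP[n ltn ->] /asboolP[n' ltn' ->] neq nrev nrev'.
  case: (ltngtP n n') neq => [nn'|n'n|->]; last by rewrite eqxx.
    by move=> _; exact: (chain_separated lossE feedbackE f_inj f_onto sep nn' ltn').
  have [r [al [rrev al01 le_r]]] :=
    chain_separated lossE feedbackE f_inj f_onto sep n'n ltn nrev' nrev.
  move=> _; exists r, (1 - al); split=> // [|j]; first by lra.
  by have := le_r j; lra.
- move=> n1 n2 i n1_ge0 n2_ge0.
  have [k [ndk le_k]] := nondominated_count_minimizer i n1_ge0 n2_ge0.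
  have [n [ltn /duplicateP[eq1 eq2]]] := chain_index lossE f_onto ndk.
  by exists (link n); rewrite eq1 eq2; split=> //; apply/asboolP; exists n.
Qed.

(** At the tie of two consecutive non-revealing actions, a revealing optimal action would either be
    dominated, hence degenerate, or duplicate one of the two, whose kept representative would then
    be revealing. *)
Lemma unseparated_two_thirds_ge : nondegenerate_game G ->
    ~~ sorted (fun i i' => revealing i || revealing i') (chain G') ->
  exists2 c : R, 0 < c & forall T, (0 < T)%N ->
    ((c * T%:R `^ (2 / 3))%:E <= minimax_regret G T)%E.
Proof.
move=> nondeg /(sortedP ord0) unsep.
have [n /not_implyP[lt /negP]] : exists n, ~ ((n.+1 < size (chain G'))%N ->
    revealing (nth ord0 (chain G') n) || revealing (nth ord0 (chain G') n.+1)).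
  by apply/existsNP => sep; apply: unsep => n; exact: sep.
rewrite !(revealing_removed feedbackE) negb_or => /andP[nreva nrevb].
have nda : ~ dominated (link n) by apply: chain_nondominated => //; exact: ltnW.
have ndb : ~ dominated (link n.+1) by apply: chain_nondominated.
have [x [x01 tie min0 only]] := chain_tie lossE f_inj f_onto lt.
apply: (minimax_regret_two_thirds_ge nda ndb (chain_ndup lt) x01 tie min0) => i rev.
rewrite lt_neqAle min0 andbT; apply/eqP => eq_i.
have x01w : 0 <= x <= 1 by lra.
have [dom|ndi] := pselect (dominated i).
  apply: nondeg; exists i; split=> //; apply: (degenerateW dom x01w) => k.
  by rewrite -eq_i.
case: (only i ndi (esym eq_i)); rewrite duplicate_sym => /f_revealing/(_ rev) reva.
  by rewrite reva in nreva.
by rewrite reva in nrevb.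
Qed.

End Removed.
End Separated.

Theorem theorem2 (R : realType) (Sigma : eqType) (G : game R Sigma 2) :
  nondegenerate_game G ->
  let K := num_nondominated G in
  let case1 := K = 1%N in
  let case2 := (2 <= K)%N /\ separation_condition G in
  let case3 := [/\ (2 <= K)%N, ~ separation_condition G &
                 exists i : 'I_(nact G).+1, revealing i] in
  [/\ case1 -> forall T : nat, (1 <= T)%N -> minimax_regret G T = 0%E,
      case2 -> is_soft_Theta (minimax_regret G) (fun T => Num.sqrt T%:R),
      case3 -> is_Theta (minimax_regret G) (fun T => T%:R `^ (2 / 3)) &
      ~ case1 -> ~ case2 -> ~ case3 ->
        is_Theta (minimax_regret G) (fun T => T%:R)].
Proof.
move=> nondeg /=; split.
- by move=> K1 T _; exact: minimax_regret_trivial.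
- move=> [K2 [G' [[f [lossE feedbackE f_inj f_onto f_revealing]] sep]]].
  have [c c_gt0 lower] := separated_sqrt_ge lossE f_inj f_onto K2.
  have [C C_gt0 upper] := separated_sqrt_le lossE feedbackE f_inj f_onto K2 sep.
  (* Both bounds are free of logarithms, hence the exponent 0. *)
  exists c, C, 0; split=> // T T2; have T0 : (0 < T)%N by exact: ltnW.
  by rewrite oppr0 powRr0 !mulr1 lower // upper.
- move=> [K2 unsep [r rev]].
  have [G' removed] := duplicates_removed_exists G.
  have [f [lossE feedbackE f_inj f_onto f_revealing]] := removed.
  have [c c_gt0 lower] : exists2 c : R, 0 < c & forall T, (0 < T)%N ->
      ((c * T%:R `^ (2 / 3))%:E <= minimax_regret G T)%E.
    apply: (unseparated_two_thirds_ge lossE feedbackE f_inj f_onto f_revealing nondeg).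
    by apply/negP => sep; apply: unsep; exists G'.
  have [C C_gt0 [T0 upper]] := minimax_regret_two_thirds_le rev.
  exists c, C; split=> //; exists T0.+1 => // T /= T0T.
  by rewrite lower ?(leq_ltn_trans _ T0T) // upper // ltnW.
- move=> K1 unsep norev.
  have K2 : (2 <= num_nondominated G)%N.
    by have := num_nondominated_gt0 G; case: num_nondominated K1 => [|[|]].
  (* A revealing action would put the game into the third case. *)
  have nrev (i : 'I_(nact G).+1) : ~~ revealing i.
    apply/negP => rev; apply: norev; split=> //; last by exists i.
    by move=> sep; exact: unsep.
  have [a [b [nda ndb ndup]]] := num_nondominated_ge2 K2.
  have [c c_gt0 lower] := minimax_regret_linear_ge nda ndb ndup nrev.
  exists c, (2 * loss_bound G + 1); split=> //.
    by rewrite ltr_wpDl // mulr_ge0 // loss_bound_ge0.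
  exists 0%N => // T _; rewrite lower /=.
  apply: le_trans (minimax_regret_le_linear G T) _.
  by rewrite lee_fin mulrC ler_wpM2r // lerDl.
Qed.
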